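(* Let $\mathcal{X}\subseteq\mathbb{R}^m$ and $\mathcal{Y}\subseteq\mathbb{R}^n$ be nonempty polytopes, $\mathcal{Z}=\mathcal{X}\times\mathcal{Y}$, $A\in\mathbb{R}^{m\times n}$, and let $\mu>0$ be arbitrary. There is a constant $c_\mu>0$, depending only on $A,\mathcal{X},\mathcal{Y},\mu$, with $$\mathrm{dist}(z,\mathcal{Z}^\mu)\le c_\mu\min_{v\in\mathcal{N}_{\mathcal{Z}}(z)}\|F_\mu^x(z)+v\|\quad\text{for all }z\in\mathcal{Z},$$ and such that, setting $$\beta_\mu:=\left(\frac{\mu}{\mu^2+\|A\|^2}+c_\mu\left(1+\frac{\mu(\mu+\|A\|)}{\mu^2+\|A\|^2}\right)\right)\left(1+\frac{\mu\|A\|}{\mu^2+\|A\|^2}\right)>0$$ (a constant independent of $\eta$), the following holds. For every learning rate $\eta$ with $0<\eta\le\frac{\mu}{\mu^2+\|A\|^2}$ and every initial point $z^1=(x^1,y^1)\in\mathcal{Z}$, the iterates $z^t=(x^t,y^t)$ of AsymP-GDA, $$x^{t+1}=\Pi_{\mathcal{X}}\left(x^t-\eta(Ay^t+\mu x^t)\right),\qquad y^{t+1}=\Pi_{\mathcal{Y}}\left(y^t+\eta A^\top x^{t+1}\right),$$ satisfy for all $t\ge1$ $$\mathrm{dist}(z^t,\mathcal{Z}^\mu)^2\le\left(\frac{1}{1+\eta^2/(2\beta_\mu^2)}\right)^{t-1}\mathrm{dist}(z^1,\mathcal{Z}^\mu)^2.$$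
   Context: A polytope is a bounded polyhedron (compact). $\|\cdot\|$ is the Euclidean norm for vectors; $\|A\|$ is the largest singular value of $A$. $\Pi_S$ is Euclidean projection onto a closed convex set $S$, and $\mathrm{dist}(a,S)=\|a-\Pi_S(a)\|$. The perturbed game is $\min_{x\in\mathcal{X}}\max_{y\in\mathcal{Y}}\{x^\top Ay+\frac{\mu}{2}\|x\|^2\}$; $x^\mu=\operatorname{argmin}_{x\in\mathcal{X}}\max_{y\in\mathcal{Y}}\{x^\top Ay+\frac{\mu}{2}\|x\|^2\}$ is its unique minimax strategy, $\mathcal{Y}^\mu=\operatorname{argmax}_{y\in\mathcal{Y}}\min_{x\in\mathcal{X}}\{x^\top Ay+\frac{\mu}{2}\|x\|^2\}$ its set of maximin strategies, and $\mathcal{Z}^\mu=\{x^\mu\}\times\mathcal{Y}^\mu$. $F_\mu^x(z)=(Ay+\mu x,\,-A^\top x)$ for $z=(x,y)$. The normal cone to a closed convex set $\mathcal{C}$ at $z\in\mathcal{C}$ is $\mathcal{N}_{\mathcal{C}}(z)=\{v:\langle v,z'-z\rangle\le0\ \forall z'\in\mathcal{C}\}$. *)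

(* Defs.v *)
From mathcomp Require Import all_boot all_order all_algebra.
From mathcomp Require Import classical_sets reals.

Set Implicit Arguments.
Unset Strict Implicit.
Unset Printing Implicit Defensive.

Import Order.TTheory GRing.Theory Num.Theory.

Local Open Scope classical_set_scope.
Local Open Scope ring_scope.

(* Points of R^m are columns 'cV[R]_m, and z = (x, y) is [col_mx x y] in
   'cV[R]_(m + n), so that the Euclidean norm, projection, distance and normal
   cone below serve for X, Y and Z alike. *)

Definition dot (R : realType) (k : nat) (u v : 'cV[R]_k) : R :=
  \sum_(i < k) u i ord0 * v i ord0.

(* The norm `|u| that MathComp-Analysis puts on matrices is the sup norm. *)
Definition norm2 (R : realType) (k : nat) (u : 'cV[R]_k) : R :=
  Num.sqrt (dot u u).

(* Greatest and least element of a set of reals; 0 if there is none. *)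
Definition maximum (R : realType) (S : set R) : R := xget 0 (S `&` ubound S).
Definition minimum (R : realType) (S : set R) : R := xget 0 (S `&` lbound S).

Definition argmin_set (R : realType) (T : Type) (S : set T) (f : T -> R)
  : set T := [set a | S a /\ forall b, S b -> f a <= f b].
Definition argmax_set (R : realType) (T : Type) (S : set T) (f : T -> R)
  : set T := [set a | S a /\ forall b, S b -> f b <= f a].

Definition singular_values (R : realType) (m n : nat) (A : 'M[R]_(m, n))
  : set R := [set s | 0 <= s /\ eigenvalue (A^T *m A) (s ^+ 2)].
Definition spectral_norm (R : realType) (m n : nat) (A : 'M[R]_(m, n)) : R :=
  maximum (singular_values A).

Definition polyhedron (R : realType) (k : nat) (S : set 'cV[R]_k) : Prop :=
  exists (p : nat) (B : 'M[R]_(p, k)) (b : 'cV[R]_p),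
    S = [set x | forall i : 'I_p, (B *m x) i ord0 <= b i ord0].
Definition polytope (R : realType) (k : nat) (S : set 'cV[R]_k) : Prop :=
  polyhedron S /\ exists M : R, forall x, S x -> norm2 x <= M.

(* Meaningful for S nonempty, closed and convex. *)
Definition proj (R : realType) (k : nat) (S : set 'cV[R]_k) (a : 'cV[R]_k)
  : 'cV[R]_k := xget 0 (argmin_set S (fun p => norm2 (a - p))).
Definition dist (R : realType) (k : nat) (a : 'cV[R]_k) (S : set 'cV[R]_k)
  : R := norm2 (a - proj S a).

Definition normal_cone (R : realType) (k : nat) (C : set 'cV[R]_k)
  (z : 'cV[R]_k) : set 'cV[R]_k :=
  [set v | forall z', C z' -> dot v (z' - z) <= 0].

Definition prod_set (R : realType) (m n : nat)
  (X : set 'cV[R]_m) (Y : set 'cV[R]_n) : set 'cV[R]_(m + n) :=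
  [set z | X (usubmx z) /\ Y (dsubmx z)].

Definition payoff (R : realType) (m n : nat) (A : 'M[R]_(m, n)) (mu : R)
  (x : 'cV[R]_m) (y : 'cV[R]_n) : R :=
  dot x (A *m y) + mu / 2 * norm2 x ^+ 2.

Definition minimax_strategy (R : realType) (m n : nat) (A : 'M[R]_(m, n))
  (X : set 'cV[R]_m) (Y : set 'cV[R]_n) (mu : R) : 'cV[R]_m :=
  xget 0 (argmin_set X (fun x => maximum [set payoff A mu x y | y in Y])).
Definition maximin_strategies (R : realType) (m n : nat) (A : 'M[R]_(m, n))
  (X : set 'cV[R]_m) (Y : set 'cV[R]_n) (mu : R) : set 'cV[R]_n :=
  argmax_set Y (fun y => minimum [set payoff A mu x y | x in X]).
Definition equilibria (R : realType) (m n : nat) (A : 'M[R]_(m, n))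
  (X : set 'cV[R]_m) (Y : set 'cV[R]_n) (mu : R) : set 'cV[R]_(m + n) :=
  prod_set [set minimax_strategy A X Y mu] (maximin_strategies A X Y mu).

Definition F_mu (R : realType) (m n : nat) (A : 'M[R]_(m, n)) (mu : R)
  (z : 'cV[R]_(m + n)) : 'cV[R]_(m + n) :=
  col_mx (A *m dsubmx z + mu *: usubmx z) (- (A^T *m usubmx z)).

Definition beta_mu (R : realType) (m n : nat) (A : 'M[R]_(m, n)) (mu c : R)
  : R :=
  let a := spectral_norm A in
  let d := mu ^+ 2 + a ^+ 2 in
  (mu / d + c * (1 + mu * (mu + a) / d)) * (1 + mu * a / d).

(* Time starts at t = 1; the values of the sequences at 0 are irrelevant. *)
Definition AsymP_GDA (R : realType) (m n : nat) (A : 'M[R]_(m, n))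
  (X : set 'cV[R]_m) (Y : set 'cV[R]_n) (mu eta : R)
  (x : nat -> 'cV[R]_m) (y : nat -> 'cV[R]_n) : Prop :=
  forall t : nat, (1 <= t)%N ->
    x t.+1 = proj X (x t - eta *: (A *m y t + mu *: x t)) /\
    y t.+1 = proj Y (y t + eta *: (A^T *m x t.+1)).

(* Main.v *)
Require Import Defs.
From mathcomp Require Import all_boot all_order all_algebra.
From mathcomp Require Import classical_sets reals topology normedtype derive.
From mathcomp Require Import ring lra.
Import Order.TTheory GRing.Theory Num.Theory.
Import numFieldNormedType.Exports.
Local Open Scope classical_set_scope.
Local Open Scope ring_scope.
Set Implicit Arguments.
Unset Strict Implicit.
Unset Printing Implicit Defensive.

(** Why the iteration converges linearly. Write a for the spectral norm of A and
    call residual of z = (x, y) the least norm of F(z) + v over the normal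
    vectors v at z.

    The equilibria are the solutions of the variational inequality of the game
    ([equilibriaP]). They exist because the dual function, which maps y to the
    minimum over X of the payoff, is Lipschitz, hence has a maximizer, and its
    gradient condition there is the inequality for y ([saddle_best_response]).
    Strong convexity in x makes the x-component of the equilibria unique.

    The error bound says that the distance to the equilibria is at most
    proportional to the residual ([error_bound]). Monotonicity bounds the square
    of the distance in x by the residual times the full distance
    ([residual_gap]). The y-component has no curvature, and the bound relies on
    X and Y being polyhedra: with the x-component x0 of the equilibria fixed, the
    admissible y form a polyhedron, described by linear inequalities in y and in
    multipliers for the constraints of X. Hoffman's lemma bounds the distance in y
    by the violation of these inequalities ([saddle_hoffman]), which is of the
    order of the residual plus the distance in x. Solving the resulting quadratic
    inequality gives the linear bound. Hoffman's lemma and the lemma of Farkas,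
    which supplies the multipliers, come out of one Fourier-Motzkin induction
    ([farkas_or_hoffman]).

    For the algorithm, the step size restriction ensures that the squared
    distance to any equilibrium decreases by at least half the squared length of
    the step ([step_descent]). The new point has a residual of at most
    (1 + eta (mu + a)) / eta times the length of the step ([step_residual]), so
    by the error bound the length of the step is at least eta / beta times the
    new distance, and the squared distance contracts by the stated factor
    ([contraction]). *)

(** * Euclidean inner product and norm *)

Lemma dotC (R : realType) k (u v : 'cV[R]_k) : dot u v = dot v u.
Proof. by apply: eq_bigr => i _; rewrite mulrC. Qed.

Lemma dotDl (R : realType) k (u v w : 'cV[R]_k) :
  dot (u + v) w = dot u w + dot v w.
Proof. by rewrite -big_split; apply: eq_bigr => i _; rewrite mxE mulrDl. Qed.

Lemma dotZl (R : realType) k a (u v : 'cV[R]_k) : dot (a *: u) v = a * dot u v.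
Proof. by rewrite /dot mulr_sumr; apply: eq_bigr => i _; rewrite mxE mulrA. Qed.

Lemma dotDr (R : realType) k (u v w : 'cV[R]_k) :
  dot w (u + v) = dot w u + dot w v.
Proof. by rewrite dotC dotDl !(dotC w). Qed.

Lemma dotZr (R : realType) k a (u v : 'cV[R]_k) : dot u (a *: v) = a * dot u v.
Proof. by rewrite dotC dotZl dotC. Qed.

Lemma dotNl (R : realType) k (u v : 'cV[R]_k) : dot (- u) v = - dot u v.
Proof. by rewrite -scaleN1r dotZl mulN1r. Qed.

Lemma dotNr (R : realType) k (u v : 'cV[R]_k) : dot u (- v) = - dot u v.
Proof. by rewrite dotC dotNl dotC. Qed.

Lemma dot0l (R : realType) k (u : 'cV[R]_k) : dot 0 u = 0.
Proof. by rewrite -(scale0r 0) dotZl mul0r. Qed.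

Lemma dot_suml (R : realType) k (I : finType) (F : I -> 'cV[R]_k) u :
  dot (\sum_i F i) u = \sum_i dot (F i) u.
Proof.
elim/big_ind2 : _ => [|x1 x2 y1 y2 <- <-|//]; first exact: dot0l.
exact: dotDl.
Qed.

Definition dotE := (dotDl, dotDr, dotNl, dotNr, dotZl, dotZr).

Lemma dot_addZ (R : realType) k t (u v : 'cV[R]_k) :
  dot (u + t *: v) (u + t *: v) = dot u u + 2 * t * dot u v + t ^+ 2 * dot v v.
Proof. by rewrite !dotE (dotC v); ring. Qed.

Lemma dot_col_mx (R : realType) m n (a c : 'cV[R]_m) (b d : 'cV[R]_n) :
  dot (col_mx a b) (col_mx c d) = dot a c + dot b d.
Proof.
rewrite /dot big_split_ord /=; congr (_ + _); apply: eq_bigr => i _.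
  by rewrite !col_mxEu.
by rewrite !col_mxEd.
Qed.

Lemma dot_mulmx (R : realType) m n (A : 'M[R]_(m, n)) x y :
  dot (A^T *m x) y = dot x (A *m y).
Proof.
have dotM k (u v : 'cV[R]_k) : dot u v = (u^T *m v) ord0 ord0.
  by rewrite mxE; apply: eq_bigr => i _; rewrite mxE.
by rewrite !dotM trmx_mul trmxK mulmxA.
Qed.

Lemma dot_row (R : realType) m n (M : 'M[R]_(m, n)) i u :
  dot (row i M)^T u = (M *m u) i ord0.
Proof. by rewrite mxE; apply: eq_bigr => j _; rewrite !mxE. Qed.

Lemma dot_ge0 (R : realType) k (u : 'cV[R]_k) : 0 <= dot u u.
Proof. by apply: sumr_ge0 => i _; rewrite -expr2 sqr_ge0. Qed.

Lemma norm2_ge0 (R : realType) k (u : 'cV[R]_k) : 0 <= norm2 u.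
Proof. exact: sqrtr_ge0. Qed.

Lemma norm2_sqr (R : realType) k (u : 'cV[R]_k) : norm2 u ^+ 2 = dot u u.
Proof. by rewrite sqr_sqrtr ?dot_ge0. Qed.

Lemma dot_eq0 (R : realType) k (u : 'cV[R]_k) : dot u u = 0 -> u = 0.
Proof.
move=> /eqP; rewrite psumr_eq0 => [/allP u0|i _]; last by rewrite -expr2 sqr_ge0.
apply/colP => i; rewrite mxE; apply/eqP; rewrite -[_ == 0]sqrf_eq0 expr2.
exact: u0 (mem_index_enum i).
Qed.

Lemma norm2_le (R : realType) k (u : 'cV[R]_k) r :
  0 <= r -> dot u u <= r ^+ 2 -> norm2 u <= r.
Proof. by move=> r0 ur; rewrite -ler_sqr ?nnegrE ?norm2_ge0 // norm2_sqr. Qed.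

Lemma norm2_mono (R : realType) k l (u : 'cV[R]_k) (v : 'cV[R]_l) :
  dot u u <= dot v v -> norm2 u <= norm2 v.
Proof. by move=> uv; apply: norm2_le (norm2_ge0 v) _; rewrite norm2_sqr. Qed.

Lemma norm2Z (R : realType) k a (u : 'cV[R]_k) : norm2 (a *: u) = `|a| * norm2 u.
Proof. by rewrite /norm2 !dotE mulrA -expr2 sqrtrM ?sqr_ge0 // sqrtr_sqr. Qed.

Lemma norm2N (R : realType) k (u : 'cV[R]_k) : norm2 (- u) = norm2 u.
Proof. by rewrite /norm2 !dotE opprK. Qed.

Lemma norm2_distC (R : realType) k (u v : 'cV[R]_k) : norm2 (u - v) = norm2 (v - u).
Proof. by rewrite -norm2N opprB. Qed.

Lemma norm20 (R : realType) k : norm2 (0 : 'cV[R]_k) = 0.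
Proof. by rewrite /norm2 dot0l sqrtr0. Qed.

(** The square of [norm2 v *: u - norm2 u *: v] is nonnegative, and equals
    twice the product of the norms times the gap of the inequality. *)
Lemma cauchy_schwarz (R : realType) k (u v : 'cV[R]_k) :
  dot u v <= norm2 u * norm2 v.
Proof.
have u0 := norm2_ge0 u; have v0 := norm2_ge0 v.
have eu := norm2_sqr u; have ev := norm2_sqr v.
have := dot_ge0 (norm2 v *: u - norm2 u *: v).
rewrite !dotE (dotC v u) -eu -ev => H.
have [/eqP|uv0] := eqVneq (norm2 u * norm2 v) 0.
  rewrite mulf_eq0 => /orP[/eqP z|/eqP z].
    by rewrite z mul0r (@dot_eq0 _ _ u) ?dot0l // -eu z expr0n.
  by rewrite z mulr0 (@dot_eq0 _ _ v) 1?dotC ?dot0l // -ev z expr0n.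
have uv : 0 < norm2 u * norm2 v by rewrite lt_def uv0 mulr_ge0.
rewrite -subr_ge0 -(pmulr_rge0 _ uv).
nra.
Qed.

Lemma norm2D (R : realType) k (u v : 'cV[R]_k) : norm2 (u + v) <= norm2 u + norm2 v.
Proof.
apply: norm2_le; first by rewrite addr_ge0 ?norm2_ge0.
have := cauchy_schwarz u v; rewrite sqrrD !norm2_sqr !dotE (dotC v u); lra.
Qed.

Lemma norm2_col_mx_le (R : realType) m n (a : 'cV[R]_m) (b : 'cV[R]_n) :
  norm2 (col_mx a b) <= norm2 a + norm2 b.
Proof.
apply: norm2_le; first by rewrite addr_ge0 ?norm2_ge0.
have := mulr_ge0 (norm2_ge0 a) (norm2_ge0 b).
rewrite sqrrD !norm2_sqr dot_col_mx; lra.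
Qed.

Lemma norm2_usubmx_le (R : realType) m n (a : 'cV[R]_m) (b : 'cV[R]_n) :
  norm2 a <= norm2 (col_mx a b).
Proof. by apply: norm2_mono; rewrite dot_col_mx lerDl dot_ge0. Qed.

Lemma norm2_dsubmx_le (R : realType) m n (a : 'cV[R]_m) (b : 'cV[R]_n) :
  norm2 b <= norm2 (col_mx a b).
Proof. by apply: norm2_mono; rewrite dot_col_mx lerDr dot_ge0. Qed.

Lemma norm2_coord_le (R : realType) k (u : 'cV[R]_k) i : `|u i ord0| <= norm2 u.
Proof.
rewrite -ler_sqr ?nnegrE ?norm2_ge0 // norm2_sqr /dot (bigD1 i) //=.
rewrite real_normK ?num_real // expr2 lerDl.
by apply: sumr_ge0 => j _; rewrite -expr2 sqr_ge0.
Qed.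

Lemma norm2_le_sum (R : realType) k (u : 'cV[R]_k) : norm2 u <= \sum_i `|u i ord0|.
Proof.
apply: norm2_le; first by apply: sumr_ge0.
rewrite expr2 mulr_suml /dot; apply: ler_sum => i _.
have -> : u i ord0 * u i ord0 = `|u i ord0| * `|u i ord0|.
  by rewrite -normrM ger0_norm // -expr2 sqr_ge0.
apply: ler_wpM2l => //; rewrite (bigD1 i) //= lerDl; exact: sumr_ge0.
Qed.

(** * Attained minima *)

(** The topology of column vectors is that of the sup norm; the Euclidean norm
    is compared to it through the sum of the absolute values of the coordinates.
    The hypothesis bounds [f u - f v] without an absolute value because [u] and
    [v] can be exchanged. *)
Lemma lipschitz_continuous (R : realType) k (f : 'cV[R]_k -> R) K :
  (forall u v, f u - f v <= K * norm2 (u - v)) -> continuous f.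
Proof.
move=> fK u; apply: (iffRL (@cvgrPdist_le _ _ _ (nbhs u) _ f (f u))) => e e0.
have K0 : 0 < `|K| * k%:R + 1 by rewrite ltr_pwDr // mulr_ge0.
pose r := e / (`|K| * k%:R + 1).
apply/nbhs_ballP; exists r => /=; first by rewrite divr_gt0.
move=> v [_ uv].
have uvk : norm2 (u - v) <= k%:R * r.
  apply: le_trans (norm2_le_sum _) _.
  rewrite -[k in k%:R]card_ord -sumr_const mulr_suml; apply: ler_sum => i _.
  rewrite mul1r !mxE; have := uv i ord0; rewrite -ball_normE; exact: ltW.
have Kuv : K * norm2 (u - v) <= e.
  have : `|K| * norm2 (u - v) <= e.
    apply: le_trans (ler_wpM2l (normr_ge0 K) uvk) _.
    rewrite mulrA mulrA ler_pdivrMr // [leRHS]mulrC.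
    by apply: ler_wpM2r; [exact: ltW|rewrite lerDl].
  by apply: le_trans; rewrite ler_wpM2r ?norm2_ge0 ?ler_norm.
rewrite ler_norml (le_trans (fK _ _) Kuv) andbT lerNl opprB.
by apply: le_trans (fK _ _) _; rewrite norm2_distC.
Qed.

Lemma dot_lipschitz (R : realType) k (c u v : 'cV[R]_k) :
  dot c u - dot c v <= norm2 c * norm2 (u - v).
Proof. by rewrite -dotNr -dotDr cauchy_schwarz. Qed.

Lemma closed_halfspaces (R : realType) k (I : Type) (c : I -> 'cV[R]_k) d :
  closed [set u | forall i, dot (c i) u <= d i].
Proof.
rewrite (_ : mkset _ = \bigcap_i (fun u => dot (c i) u) @^-1` [set r | r <= d i]).
  apply: closed_bigI => i _; apply: preimage_closed => [u _|]; last exact: closed_le.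
  by apply: lipschitz_continuous => x y; exact: dot_lipschitz.
by apply/seteqP; split=> u /= H i => [_|]; exact: H.
Qed.

Lemma trmx_continuous (T : topologicalType) m n :
  continuous (@trmx T m n).
Proof.
move=> M U [P MP PU]; exists (fun i j => P j i) => [i j|N NP].
  by have := MP j i; rewrite mxE.
by apply: PU => i j; rewrite mxE.
Qed.

(** Extreme value theorem on a closed bounded set of columns. *)
Lemma attained_min (R : realType) k (S : set 'cV[R]_k) (f : 'cV[R]_k -> R) K M :
    closed S -> (forall u, S u -> norm2 u <= M) -> S !=set0 ->
    (forall u v, f u - f v <= K * norm2 (u - v)) ->
  exists u, argmin_set S f u.
Proof.
move=> Scl SM [u0 Su0] fK.
have fc := lipschitz_continuous fK.
(* Heine-Borel is applied to row vectors, hence the transposed copy of S. *)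
pose T := (@trmx R 1 k) @^-1` S.
have cT : compact T.
  apply: bounded_closed_compact.
    exists M; split; first exact: num_real.
    move=> r Mr v Tv; rewrite /= [`|v|]mx_normrE; apply/bigmax_leP.
    split=> [|[i j] _].
      by rewrite (le_trans _ (ltW Mr)) // (le_trans (norm2_ge0 _) (SM _ Su0)).
    have := norm2_coord_le (v^T) j; rewrite mxE (ord1 i) => vj.
    exact: le_trans vj (le_trans (SM _ Tv) (ltW Mr)).
  by apply: preimage_closed => // v _; exact: trmx_continuous.
have T0 : T !=set0 by exists u0^T; rewrite /T /= trmxK.
have [|v vT vmin] := @EVT_min_rV R k (f \o trmx) T T0 cT.
  apply: continuous_subspaceT => v; apply: continuous_comp; first exact: trmx_continuous.
  exact: fc.
exists v^T; split; first by rewrite inE in vT.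
move=> b Sb; have := vmin b^T; rewrite inE /T /= trmxK; exact.
Qed.

(** * Linear inequalities: the lemmas of Farkas and Hoffman *)

(** A violated upper constraint [g i0 * t <= b i0] forces [t] below zero. The
    largest [t] satisfying all the upper constraints also satisfies the lower
    ones, by compatibility of each pair, and it is no larger in absolute value
    than the violation [r] divided by some [g i]. *)
Lemma shift_below (R : realType) (I : finType) (g b : I -> R) r i0 :
    (forall i, - r <= b i) -> (forall i, g i = 0 -> 0 <= b i) ->
    (forall i j, 0 < g i -> g j < 0 -> g j * b i <= g i * b j) ->
    0 < g i0 -> b i0 < 0 ->
  exists2 t, `|t| <= (\sum_i `|g i|^-1) * r & forall i, g i * t <= b i.
Proof.
move=> br b0 bb gi0 bi0.
case: (@Order.TotalTheory.arg_minP _ _ I i0 (fun i => 0 < g i) (fun i => b i / g i) gi0).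
move=> i gi imin.
have t0 : b i / g i < 0.
  by apply: le_lt_trans (imin _ gi0) _; rewrite pmulr_llt0 // invr_gt0.
exists (b i / g i) => [|j].
  rewrite ltr0_norm // -mulNr (bigD1 i) //= mulrDl (gtr0_norm gi) [_^-1 * r]mulrC.
  apply: ler_wpDr; last by rewrite ler_wpM2r ?invr_ge0 ?(ltW gi) // lerNl.
  rewrite mulr_ge0 ?sumr_ge0 // => [j _|]; first by rewrite invr_ge0.
  by have := br i0; lra.
have [gj|gj|gj] := ltgtP (g j) 0.
- by rewrite mulrA ler_pdivrMr // [b j * _]mulrC bb.
- by rewrite mulrC -ler_pdivlMr // imin.
- by rewrite gj mul0r b0.
Qed.

(** Fourier-Motzkin elimination of one variable [t] from the constraints
    [g i * t <= b i]. The new constraints, indexed by [J], are the nonnegative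
    combinations, with weights [w], in which [t] cancels: the old constraints
    without [t], and each pair of opposite signs. The quantitative part is that
    a point violating the old constraints by at most [r] and satisfying the new
    ones is repaired by a shift of size at most [K * r]. *)
Lemma eliminate_variable (R : realType) (I : finType) (g : I -> R) :
  exists (J : finType) (w : J -> I -> R) (K : R),
    [/\ 0 <= K, forall a i, 0 <= w a i, forall a, \sum_i w a i * g i = 0 &
      forall b r, 0 <= r -> (forall i, - r <= b i) ->
        (forall a, 0 <= \sum_i w a i * b i) ->
        exists2 t, `|t| <= K * r & forall i, g i * t <= b i].
Proof.
(* Indices that are not of one of the two useful kinds carry zero weights. *)
pose w (a : I + I * I) i : R :=
  match a with
  | inl j => ((g j == 0) && (i == j))%:R
  | inr (j, l) =>
    if (0 < g j) && (g l < 0) then - g l * (i == j)%:R + g j * (i == l)%:R else 0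
  end.
have pick j (F : I -> R) : \sum_i (i == j)%:R * F i = F j.
  rewrite (bigD1 j) //= eqxx mul1r big1 ?addr0 // => i /negbTE ->.
  by rewrite mul0r.
have wl j F : g j = 0 -> \sum_i w (inl j) i * F i = F j.
  by move=> gj; rewrite -[RHS]pick; apply: eq_bigr => i _; rewrite /= gj eqxx.
have wr j l F : 0 < g j -> g l < 0 ->
    \sum_i w (inr (j, l)) i * F i = - g l * F j + g j * F l.
  move=> gj gl; rewrite -(pick j) -(pick l F) !mulr_sumr -big_split /=.
  by apply: eq_bigr => i _; rewrite gj gl /= mulrDl !mulrA.
exists (I + I * I)%type, w, (\sum_i `|g i|^-1); split.
- by apply: sumr_ge0 => i _; rewrite invr_ge0.
- move=> [j|[j l]] i /=; first exact: ler0n.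
  case: ifP => // /andP[gj gl].
  by rewrite addr_ge0 // mulr_ge0 ?ler0n ?oppr_ge0 // ltW.
- move=> [j|[j l]].
    have [gj|gj] := eqVneq (g j) 0; first by rewrite wl.
    by apply: big1 => i _; rewrite /= (negbTE gj) mul0r.
  have [/andP[gj gl]|gjl] := boolP ((0 < g j) && (g l < 0)).
    by rewrite wr // mulNr addrC mulrC subrr.
  by apply: big1 => i _; rewrite /= (negbTE gjl) mul0r.
move=> b r r0 br bw.
have b0 i : g i = 0 -> 0 <= b i by move=> gi; rewrite -(wl i b gi).
have bb i j : 0 < g i -> g j < 0 -> g j * b i <= g i * b j.
  by move=> gi gj; have := bw (inr (i, j)); rewrite wr // mulNr addrC subr_ge0.
have [/existsP[i /andP[gi bi]]|/existsPn np] := boolP [exists i, (0 < g i) && (b i < 0)].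
  exact: shift_below br b0 bb gi bi.
have [/existsP[i /andP[gi bi]]|/existsPn nn] := boolP [exists i, (g i < 0) && (b i < 0)].
  have [i' /eqP|i' j'|||t tr tb] := @shift_below R I (fun i => - g i) b r i br.
  - by rewrite oppr_eq0 => /eqP /b0.
  - by rewrite oppr_gt0 oppr_lt0 => gi' gj'; have := bb _ _ gj' gi'; rewrite !mulNr; lra.
  - by rewrite oppr_gt0.
  - by [].
  exists (- t); last by move=> j; rewrite mulrN -mulNr.
  by rewrite normrN (le_trans tr) // ler_wpM2r // ler_sum // => j _; rewrite normrN.
exists 0; first by rewrite normr0 mulr_ge0 // sumr_ge0 // => i _; rewrite invr_ge0.
move=> i; rewrite mulr0.
have := np i; have := nn i; rewrite !negb_and -!leNgt; have := b0 i.
by case: (ltgtP (g i) 0) => [gi _|gi _|gi /(_ gi) ->] //=; rewrite orbF.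
Qed.

(** Infeasibility of [dot (c i) y <= d i] is certified by multipliers, and
    otherwise an approximate solution has an exact one nearby. Both alternatives
    pass through the elimination of a variable: certificates are pulled back
    along the weights, solutions are pushed forward by the shift. The induction
    is on the number [l] of leading coordinates on which the constraints depend,
    inside a fixed space. That [K] is chosen before [d] matters: the constraints
    of the eliminated system have the right-hand sides [\sum_i w a i * d i]. *)
Lemma farkas_or_hoffman_supported (R : realType) k l (I : finType) (c : I -> 'cV[R]_k) :
    (forall i (j : 'I_k), (l <= j)%N -> c i j ord0 = 0) ->
  exists2 K, 0 <= K & forall d : I -> R,
    (exists m : I -> R, [/\ forall i, 0 <= m i, \sum_i m i *: c i = 0 &
                            \sum_i m i * d i < 0]) \/
    (forall y r, 0 <= r -> (forall i, dot (c i) y <= d i + r) ->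
       exists2 y', forall i, dot (c i) y' <= d i & norm2 (y' - y) <= K * r).
Proof.
elim: l I c => [|l IH] I c cl.
  exists 0 => // d.
  have c0 i : c i = 0 by apply/colP => j; rewrite cl // mxE.
  have [/existsP[i di]|/existsPn dge] := boolP [exists i, d i < 0].
    left; exists (fun j => (j == i)%:R); split=> [j||]; first exact: ler0n.
      by apply: big1 => j _; rewrite c0 scaler0.
    rewrite (bigD1 i) //= eqxx mul1r big1 ?addr0 // => j /negbTE ->.
    by rewrite mul0r.
  right=> y r r0 _; exists y => [i|]; first by rewrite c0 dot0l leNgt.
  by rewrite subrr norm20 mul0r.
have [kl|lk] := leqP k l.
  by apply: IH => i j lj; have := leq_trans kl lj; rewrite leqNgt ltn_ord.
pose j0 := Ordinal lk; pose e : 'cV[R]_k := delta_mx j0 ord0.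
have ce i : dot (c i) e = c i j0 ord0.
  rewrite /dot (bigD1 j0) //= big1 ?mxE ?eqxx ?mulr1 ?addr0 // => j jj0.
  by rewrite mxE (negbTE jj0) mulr0.
have [J [w [K [K0 w0 wg wP]]]] := eliminate_variable (fun i => dot (c i) e).
pose c' a := \sum_i w a i *: c i.
have dotc' a y : dot (c' a) y = \sum_i w a i * dot (c i) y.
  by rewrite dot_suml; apply: eq_bigr => i _; rewrite dotZl.
have [|K' K'0 HK'] := IH J c'.
  move=> a j; rewrite leq_eqVlt => /orP[/eqP lj|lj].
    have -> : j = j0 by apply: val_inj.
    rewrite summxE -[RHS](wg a); apply: eq_bigr => i _.
    by rewrite mxE ce.
  by rewrite summxE big1 // => i _; rewrite mxE cl // mulr0.
pose W := \sum_a \sum_i w a i; pose C := \sum_i norm2 (c i).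
have W0 : 0 <= W by apply: sumr_ge0 => a _; apply: sumr_ge0.
have C0 : 0 <= C by apply: sumr_ge0 => i _; apply: norm2_ge0.
(* Violation r becomes at most W * r after elimination, and the repair of the
   eliminated system moves y by K' * W * r, raising the violation of the
   original constraints to at most r + C * (K' * W * r) before the shift. *)
exists (K' * W + K * (1 + C * (K' * W)) * norm2 e).
  by rewrite !(addr_ge0, mulr_ge0) ?norm2_ge0.
move=> d; case: (HK' (fun a => \sum_i w a i * d i)) => [[m [m0 mc md]]|hoff].
  left; exists (fun i => \sum_a m a * w a i); split.
  - by move=> i; apply: sumr_ge0 => a _; rewrite mulr_ge0.
  - rewrite -[RHS]mc; under eq_bigr do rewrite scaler_suml.
    rewrite exchange_big; apply: eq_bigr => a _ /=.
    by rewrite scaler_sumr; apply: eq_bigr => i _; rewrite scalerA.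
  - congr (_ < 0): md; under [RHS]eq_bigr do rewrite mulr_suml.
    rewrite exchange_big; apply: eq_bigr => a _ /=.
    by rewrite mulr_sumr; apply: eq_bigr => i _; rewrite mulrA.
right=> y r r0 yr.
have [||y' y'c y'y] := hoff y (W * r); first exact: mulr_ge0.
  move=> a; apply: (@le_trans _ _ (\sum_i w a i * (d i + r))).
    by rewrite dotc'; apply: ler_sum => i _; apply: ler_wpM2l.
  under eq_bigr do rewrite mulrDr; rewrite big_split /= lerD2l -mulr_suml.
  apply: ler_wpM2r => //; rewrite /W (bigD1 a) //= lerDl.
  by apply: sumr_ge0 => ? _; apply: sumr_ge0.
have [|i|a|t tr tb] := wP (fun i => d i - dot (c i) y') (r + C * (K' * (W * r))).
- by rewrite addr_ge0 // !mulr_ge0.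
- have ciC : norm2 (c i) <= C.
    by rewrite /C (bigD1 i) //= lerDl sumr_ge0 // => ? _; apply: norm2_ge0.
  have h : dot (c i) y' - dot (c i) y <= C * (K' * (W * r)).
    apply: le_trans (dot_lipschitz _ _ _) _.
    by rewrite ler_pM ?norm2_ge0.
  by have := yr i; lra.
- under eq_bigr do rewrite mulrBr.
  by rewrite sumrB subr_ge0 -dotc'.
exists (y' + t *: e) => [i|].
  by have := tb i; rewrite dotDr dotZr; lra.
rewrite addrAC; apply: le_trans (norm2D _ _) _; rewrite norm2Z !mulrDl.
rewrite -mulrA; apply: lerD => //.
rewrite mulrAC; apply: ler_wpM2r; first exact: norm2_ge0.
by apply: le_trans tr _; lra.
Qed.

Lemma farkas_or_hoffman (R : realType) k (I : finType) (c : I -> 'cV[R]_k) :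
  exists2 K, 0 <= K & forall d : I -> R,
    (exists m : I -> R, [/\ forall i, 0 <= m i, \sum_i m i *: c i = 0 &
                            \sum_i m i * d i < 0]) \/
    (forall y r, 0 <= r -> (forall i, dot (c i) y <= d i + r) ->
       exists2 y', forall i, dot (c i) y' <= d i & norm2 (y' - y) <= K * r).
Proof.
apply: (@farkas_or_hoffman_supported _ _ k) => i j.
by rewrite leqNgt ltn_ord.
Qed.

Lemma farkas (R : realType) k (I : finType) (c : I -> 'cV[R]_k) (d : I -> R) :
    ~ (exists y, forall i, dot (c i) y <= d i) ->
  exists l : I -> R, [/\ forall i, 0 <= l i, \sum_i l i *: c i = 0 &
                         \sum_i l i * d i < 0].
Proof.
move=> nfeas; have [K _ HK] := farkas_or_hoffman c; case: (HK d) => // hoff.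
case: nfeas; have [||y yc _] := hoff 0 (\sum_i `|d i|); last by exists y.
- exact: sumr_ge0.
- move=> i; rewrite dotC dot0l (bigD1 i) //= addrA.
  have : 0 <= \sum_(j | j != i) `|d j| by apply: sumr_ge0.
  by have := ler_norm (- d i); rewrite normrN; lra.
Qed.

(** Hoffman's bound: the distance to a nonempty polyhedron is at most
    proportional to the violation of its constraints, with a factor that depends
    on the normals only. *)
Lemma hoffman (R : realType) k (I : finType) (c : I -> 'cV[R]_k) :
  exists2 K, 0 <= K & forall d : I -> R,
    (exists y, forall i, dot (c i) y <= d i) ->
    forall y r, 0 <= r -> (forall i, dot (c i) y <= d i + r) ->
      exists2 y', forall i, dot (c i) y' <= d i & norm2 (y' - y) <= K * r.
Proof.
have [K K0 HK] := farkas_or_hoffman c; exists K => // d [y yd].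
case: (HK d) => // -[l [l0 lc ld]].
have : dot (\sum_i l i *: c i) y <= \sum_i l i * d i.
  rewrite dot_suml; apply: ler_sum => i _.
  by rewrite dotZl ler_wpM2l.
by rewrite lc dot0l leNgt ld.
Qed.

(** Linear programming duality: a normal vector is a nonnegative combination of
    the active rows, and complementary slackness records that inactive rows have
    weight zero. By Farkas' lemma it is enough that no direction [w] which keeps
    the active constraints satisfies [1 <= dot v w]: a short step along such a
    [w] would stay in the polyhedron. *)
Lemma normal_cone_polyhedron (R : realType) p k (B : 'M[R]_(p, k)) (b : 'cV[R]_p)
    (S := [set x | forall i, (B *m x) i ord0 <= b i ord0]) x v :
    S x -> normal_cone S x v ->
  exists l : 'cV[R]_p, [/\ forall i, 0 <= l i ord0, B^T *m l = v &
                           dot l (b - B *m x) = 0].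
Proof.
move=> Sx Nv.
pose s i := b i ord0 - (B *m x) i ord0.
have s0 i : 0 <= s i by rewrite subr_ge0; exact: Sx.
pose c (o : option 'I_p) : 'cV[R]_k :=
  if o is Some i then if s i == 0 then (row i B)^T else 0 else - v.
pose d (o : option 'I_p) : R := if o is Some _ then 0 else -1.
have [[w wc]|l [l0 lc ld]] := @farkas _ _ _ c d.
  (* 1 / q is a step length for which no inactive constraint becomes violated;
     active ones contribute nothing to the sum, since their slack is 0. *)
  pose q := 1 + \sum_i `|(B *m w) i ord0| / s i.
  have q0 : 0 < q.
    by rewrite ltr_pwDl // sumr_ge0 // => i _; rewrite divr_ge0.
  have Sw : S (x + q^-1 *: w).
    move=> i; rewrite mulmxDr -scalemxAr mxE [X in _ + X]mxE -lerBrDl -/(s i).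
    have [si|si] := eqVneq (s i) 0.
      have := wc (Some i); rewrite /= si eqxx dot_row => wi.
      by rewrite mulr_ge0_le0 // invr_ge0 ltW.
    rewrite mulrC ler_pdivrMr //.
    have sip : 0 < s i by rewrite lt_def si s0.
    rewrite mulrC -ler_pdivrMr //.
    apply: (@le_trans _ _ (`|(B *m w) i ord0| / s i)).
      by rewrite ler_wpM2r ?invr_ge0 ?ler_norm.
    rewrite /q (bigD1 i) //=.
    have : 0 <= \sum_(j | j != i) `|(B *m w) j ord0| / s j.
      by apply: sumr_ge0 => j _; rewrite divr_ge0.
    lra.
  have := Nv _ Sw; rewrite addrC addKr dotZr pmulr_rle0 ?invr_gt0 //.
  by have := wc None; rewrite /= dotNl; lra.
have big_opt (V : zmodType) (F : option 'I_p -> V) :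
    \sum_o F o = F None + \sum_i F (Some i).
  rewrite (bigD1 None) //=; congr (_ + _).
  rewrite (reindex_omap Some id) //=; last by case.
  by apply: eq_bigl => i; rewrite eqxx.
move: lc ld; rewrite !big_opt /= mulrN1.
rewrite [X in _ + X < 0]big1 => [lc|i _]; last by rewrite mulr0.
rewrite addr0 oppr_lt0 => lN.
exists (\col_i (if s i == 0 then l (Some i) / l None else 0)); split.
- move=> i; rewrite mxE; case: ifP => // _.
  by rewrite divr_ge0 // ltW.
- have -> : v = (l None)^-1 *: \sum_i l (Some i) *: c (Some i).
    move/eqP: lc; rewrite scalerN addrC subr_eq0 => /eqP ->.
    by rewrite scalerA mulVf ?scale1r ?gt_eqF.
  apply/colP => j; rewrite mxE [RHS]mxE summxE mulr_sumr; apply: eq_bigr => i _.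
  rewrite /c !mxE; case: ifP => _; rewrite !mxE.
    by ring.
  by rewrite !mulr0.
- apply: big1 => i _; rewrite !mxE -[X in _ * X]/(b i ord0 - _).
  case: ifP => [/eqP|_]; last by rewrite mul0r.
  by rewrite /s mxE => ->; rewrite mulr0.
Qed.

(** * Projections *)

Lemma minimumE (R : realType) (S : set R) a :
  S a -> (forall b, S b -> a <= b) -> minimum S = a.
Proof.
move=> Sa aS; apply: xget_subset1; first by split.
by move=> b c [Sb bS] [Sc cS]; apply/eqP; rewrite eq_le bS // cS.
Qed.

Lemma maximumE (R : realType) (S : set R) a :
  S a -> (forall b, S b -> b <= a) -> maximum S = a.
Proof.
move=> Sa aS; apply: xget_subset1; first by split.
by move=> b c [Sb bS] [Sc cS]; apply/eqP; rewrite eq_le bS // cS.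
Qed.

Lemma norm2_dist_lipschitz (R : realType) k (a u v : 'cV[R]_k) :
  norm2 (a - u) - norm2 (a - v) <= 1 * norm2 (u - v).
Proof.
rewrite mul1r lerBlDr (norm2_distC u).
by rewrite [norm2 (v - u) + _]addrC (le_trans _ (norm2D _ _)) // addrA subrK.
Qed.

(** Points farther from [a] than a fixed [u0] of [S] can be discarded, which
    leaves a bounded set. *)
Lemma nearest_point (R : realType) k (S : set 'cV[R]_k) a :
  closed S -> S !=set0 -> exists p, argmin_set S (fun p => norm2 (a - p)) p.
Proof.
move=> Scl [u0 Su0].
pose T := S `&` (fun u => norm2 (a - u)) @^-1` [set r | r <= norm2 (a - u0)].
have lip := norm2_dist_lipschitz a.
have [|||p [[Sp pu0] pmin]] := @attained_min R k T (fun u => norm2 (a - u)) 1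
  (norm2 a + norm2 (a - u0)) _ _ _ lip.
- apply: closedI => //; apply: preimage_closed => [u _|]; last exact: closed_le.
  exact: lipschitz_continuous lip _.
- move=> u [_ au]; have -> : u = a - (a - u) by rewrite opprB addrC subrK.
  by apply: le_trans (norm2D _ _) _; rewrite norm2N lerD2l.
- by exists u0; split=> //=.
exists p; split=> // b Sb.
have [ab|ab] := leP (norm2 (a - b)) (norm2 (a - u0)); first exact: pmin.
exact: le_trans pu0 (ltW ab).
Qed.

Lemma proj_in (R : realType) k (S : set 'cV[R]_k) a :
  closed S -> S !=set0 -> S (proj S a).
Proof. by move=> Scl S0; case: (xgetPex 0 (nearest_point a Scl S0)). Qed.

Lemma dist_le (R : realType) k (S : set 'cV[R]_k) a s :
  closed S -> S s -> dist a S <= norm2 (a - s).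
Proof.
move=> Scl Ss; have [|_] := xgetPex 0 (@nearest_point _ _ S a Scl _).
  by exists s.
exact.
Qed.

Definition convex_set (R : realType) k (S : set 'cV[R]_k) :=
  forall x y t, S x -> S y -> 0 <= t -> t <= 1 -> S (x + t *: (y - x)).

(** Moving from the projection towards [s] by a small fraction [t] of the way
    would decrease the distance to [a] if the inner product were positive. *)
Lemma proj_obtuse (R : realType) k (S : set 'cV[R]_k) a s :
  closed S -> convex_set S -> S s -> dot (a - proj S a) (s - proj S a) <= 0.
Proof.
move=> Scl Scv Ss; have [|] := xgetPex 0 (@nearest_point _ _ S a Scl _).
  by exists s.
rewrite -/(proj S a); set p := proj S a => Sp pmin.
rewrite leNgt; apply/negP => q0.
set q := dot _ _ in q0; pose N := dot (s - p) (s - p).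
have N0 : 0 <= N by apply: dot_ge0.
pose t := q / (q + N).
have qN : 0 < q + N by lra.
have t0 : 0 < t by rewrite divr_gt0.
have tqN : t * (q + N) = q by rewrite divfK ?gt_eqF.
have t1 : t <= 1 by rewrite ler_pdivrMr // mul1r; lra.
have := pmin _ (Scv p s t Sp Ss (ltW t0) t1).
rewrite -ler_sqr ?nnegrE ?norm2_ge0 // !norm2_sqr opprD addrA.
rewrite -scaleNr dot_addZ -/q -/N => H.
have : 0 <= t * (t * N - 2 * q) by nra.
rewrite pmulr_rge0 //; nra.
Qed.

Lemma polyhedron_closed (R : realType) k (S : set 'cV[R]_k) :
  polyhedron S -> closed S.
Proof.
move=> [p [B [b ->]]].
rewrite (_ : mkset _ = [set x | forall i, dot (row i B)^T x <= b i ord0]).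
  exact: closed_halfspaces.
by apply/seteqP; split=> x /= H i; have := H i; rewrite dot_row.
Qed.

Lemma polyhedron_convex (R : realType) k (S : set 'cV[R]_k) :
  polyhedron S -> convex_set S.
Proof.
move=> [p [B [b ->]]] x y t xb yb t0 t1 i.
have := xb i; have := yb i; rewrite mulmxDr -scalemxAr mulmxBr !mxE.
by move=> ? ?; nra.
Qed.

(** * The spectral norm *)

Lemma mulmx_bounded (R : realType) m n (A : 'M[R]_(m, n)) :
  exists2 K, 0 <= K & forall w, norm2 (A *m w) <= K * norm2 w.
Proof.
exists (\sum_i norm2 (row i A)^T); first by apply: sumr_ge0 => i _; apply: norm2_ge0.
move=> w; apply: le_trans (norm2_le_sum _) _; rewrite mulr_suml; apply: ler_sum => i _.
by rewrite -dot_row ler_norml cauchy_schwarz lerNl -dotNl -[norm2 _]norm2N cauchy_schwarz.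
Qed.

Lemma spectral_norm_ge0 (R : realType) m n (A : 'M[R]_(m, n)) : 0 <= spectral_norm A.
Proof. by rewrite /spectral_norm /maximum; case: xgetP => // s _ [[]]. Qed.

(** The maximum [s] of the norm of [A *m v] on the unit sphere is a singular
    value, because the derivative at a maximizer [v] of the nonnegative
    form [s ^+ 2 * dot w w - dot (A *m w) (A *m w)] vanishes; and no singular
    value exceeds [s]. Hence [s] is the spectral norm. *)
Lemma spectral_norm_bound (R : realType) m n (A : 'M[R]_(m, n)) y :
  norm2 (A *m y) <= spectral_norm A * norm2 y.
Proof.
have [->|y0] := eqVneq y 0; first by rewrite mulmx0 !norm20 mulr0.
have norm_gt0 (w : 'cV[R]_n) : w != 0 -> 0 < norm2 w.
  move=> w0; rewrite lt_def norm2_ge0 andbT; apply: contraNneq w0 => nw.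
  by apply/eqP/dot_eq0; rewrite -norm2_sqr nw expr0n.
have unit_norm (w : 'cV[R]_n) : w != 0 -> norm2 ((norm2 w)^-1 *: w) = 1.
  move=> w0; rewrite norm2Z ger0_norm ?invr_ge0 ?norm2_ge0 // mulVf //.
  by rewrite gt_eqF ?norm_gt0.
have [K K0 AK] := mulmx_bounded A.
have sphere_cl : closed ((@norm2 R n) @^-1` [set 1]).
  apply: preimage_closed => [u _|]; last exact: closed_eq.
  apply: (@lipschitz_continuous _ _ _ 1) => x z; rewrite mul1r lerBlDr.
  by apply: le_trans (norm2D _ _); rewrite subrK.
have [|||v [v1 vmax]] := @attained_min R n _ (fun u => - norm2 (A *m u)) K 1 sphere_cl.
- by move=> u ->.
- by exists ((norm2 y)^-1 *: y); apply: unit_norm.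
- move=> u v; rewrite opprK addrC lerBlDr norm2_distC.
  apply: le_trans (_ : norm2 (A *m (v - u)) + norm2 (A *m u) <= _).
    by apply: le_trans (norm2D _ _); rewrite mulmxBr subrK.
  by rewrite lerD2r.
pose s := norm2 (A *m v).
have s0 : 0 <= s by apply: norm2_ge0.
have As w : norm2 (A *m w) <= s * norm2 w.
  have [->|w0] := eqVneq w 0; first by rewrite mulmx0 !norm20 mulr0.
  have := vmax _ (unit_norm w w0); rewrite lerN2 -scalemxAr norm2Z.
  rewrite ger0_norm ?invr_ge0 ?norm2_ge0 // mulrC.
  by rewrite ler_pdivrMr ?norm_gt0.
have As2 w : dot (A *m w) (A *m w) <= s ^+ 2 * dot w w.
  by rewrite -!norm2_sqr -exprMn ler_sqr ?nnegrE ?mulr_ge0 ?norm2_ge0.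
(* Up to a factor, w is the gradient at v of the form; As2 is applied to a small
   step from v in the direction w. *)
pose w := A^T *m (A *m v) - s ^+ 2 *: v.
have w0 : w = 0.
  apply: dot_eq0; apply/eqP; rewrite eq_le dot_ge0 andbT.
  pose t := (s ^+ 2 + 1)^-1.
  have s2 : 0 < s ^+ 2 + 1 by rewrite ltr_pwDr // sqr_ge0.
  have t0 : 0 < t by rewrite invr_gt0.
  have ts : t * (s ^+ 2 + 1) = 1 by rewrite mulVf ?gt_eqF.
  have vw : dot (A *m v) (A *m w) = dot w w + s ^+ 2 * dot v w.
    by rewrite {1}/w dotDl dotNl dotZl dot_mulmx subrK.
  have := As2 (v + t *: w); rewrite mulmxDr -scalemxAr !dot_addZ vw.
  rewrite -[dot v v]norm2_sqr -[dot (A *m v) _]norm2_sqr v1 -/s => H.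
  have := mulr_ge0 (sqr_ge0 t) (dot_ge0 (A *m w)); have ww0 := dot_ge0 w => tAw.
  have : 0 <= t * (t * s ^+ 2 * dot w w - 2 * dot w w) by nra.
  rewrite pmulr_rge0 //; nra.
have /eqP AAv : A^T *m (A *m v) == s ^+ 2 *: v by rewrite -subr_eq0; apply/eqP.
rewrite /spectral_norm (@maximumE _ _ s) //; first split=> //.
  apply/eigenvalueP; exists v^T; last first.
    rewrite -trmx0 (inj_eq (can_inj (@trmxK _ _ _))); apply/eqP => v0.
    by move: v1; rewrite v0 /= norm20 => /eqP; rewrite eq_sym oner_eq0.
  by apply: trmx_inj; rewrite trmx_mul trmxK linearZ /= trmxK trmx_mul trmxK -mulmxA AAv.
move=> r [r0 /eigenvalueP[u uA u0]].
have u0' : u^T != 0 by rewrite -trmx0 (inj_eq (can_inj (@trmxK _ _ _))).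
have AAu : A^T *m (A *m u^T) = r ^+ 2 *: u^T.
  by apply: trmx_inj; rewrite mulmxA trmx_mul trmx_mul !trmxK linearZ /= trmxK.
have := As2 u^T; rewrite -dot_mulmx AAu dotZl -norm2_sqr.
by rewrite ler_pM2r ?exprn_gt0 ?norm_gt0 // ler_sqr.
Qed.

Lemma dot_mulmx_le (R : realType) m n (A : 'M[R]_(m, n)) x y :
  dot x (A *m y) <= spectral_norm A * norm2 x * norm2 y.
Proof.
apply: le_trans (cauchy_schwarz _ _) _; rewrite [_ * norm2 x]mulrC -mulrA.
by apply: ler_wpM2l; [exact: norm2_ge0|exact: spectral_norm_bound].
Qed.

(** * Saddle points of the perturbed game *)

Lemma submx_continuous (T : topologicalType) m n :
  continuous (@usubmx T m n 1) /\ continuous (@dsubmx T m n 1).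
Proof.
split=> M U [P MP PU].
  exists (fun i j => if split i is inl i' then P i' j else setT) => [i j|N NP].
    case E: (split i) => [i'|i']; last exact: filterT.
    by have := MP i' j; rewrite mxE -[i]splitK E.
  by apply: PU => i j; have := NP (lshift n i) j; rewrite (unsplitK (inl i)) mxE.
exists (fun i j => if split i is inr i' then P i' j else setT) => [i j|N NP].
  case E: (split i) => [i'|i']; first exact: filterT.
  by have := MP i' j; rewrite mxE -[i]splitK E.
by apply: PU => i j; have := NP (rshift m i) j; rewrite (unsplitK (inr i)) mxE.
Qed.

Lemma prod_set_closed (R : realType) m n (X : set 'cV[R]_m) (Y : set 'cV[R]_n) :
  closed X -> closed Y -> closed (prod_set X Y).
Proof.
have [uc dc] := submx_continuous R m n.
move=> Xcl Ycl; apply: closedI; exact: preimage_closed.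
Qed.

(** A pair satisfying the variational inequality of the perturbed game. This
    first-order form is linear in [y] once [x] is fixed, which is what the error
    bound exploits; [equilibriaP] identifies it with the equilibria. *)
Definition saddle (R : realType) m n (A : 'M[R]_(m, n)) X Y mu x y :=
  [/\ X x, Y y,
      forall x', X x' -> 0 <= dot (A *m y + mu *: x) (x' - x) &
      forall y', Y y' -> dot x (A *m (y' - y)) <= 0].

Lemma payoff_addl (R : realType) m n (A : 'M[R]_(m, n)) mu x x' y :
  payoff A mu x' y = payoff A mu x y + dot (A *m y + mu *: x) (x' - x)
                     + mu / 2 * dot (x' - x) (x' - x).
Proof.
rewrite /payoff !norm2_sqr !dotE (dotC x' x) (dotC _ (A *m y)) (dotC _ (A *m y)).
by field.
Qed.

Lemma payoff_addr (R : realType) m n (A : 'M[R]_(m, n)) mu x y y' :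
  payoff A mu x y' = payoff A mu x y + dot x (A *m (y' - y)).
Proof. by rewrite /payoff mulmxBr !dotE; ring. Qed.

(** Linear arithmetic below concerns the values of inner products only; hiding
    the vectors prevents costly comparisons of them up to conversion. *)
Ltac scalars := repeat match goal with
  | |- context [dot ?u ?v] => let r := fresh "r" in move: (dot u v) => r
  | |- context [norm2 ?u] => let r := fresh "r" in move: (norm2 u) => r
  | |- context [payoff ?A ?mu ?x ?y] =>
      let r := fresh "r" in move: (payoff A mu x y) => r
  end.

(** The minimizer over X of the payoff against y, obtained by completing the
    square. *)
Definition best_response (R : realType) m n (A : 'M[R]_(m, n)) X mu y :=
  proj X (- (mu^-1 *: (A *m y))).

Section Saddle.

Context (R : realType) (m n : nat) (A : 'M[R]_(m, n)).
Context (X : set 'cV[R]_m) (Y : set 'cV[R]_n) (mu : R).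
Context (X_polytope : polytope X) (Y_polytope : polytope Y).
Context (X_nonempty : X !=set0) (Y_nonempty : Y !=set0) (mu_gt0 : 0 < mu).

Let Xcl : closed X := polyhedron_closed X_polytope.1.
Let Ycl : closed Y := polyhedron_closed Y_polytope.1.
Local Notation L := (payoff A mu).
Local Notation br := (best_response A X mu).

Lemma best_response_in y : X (br y).
Proof. exact: proj_in. Qed.

Lemma best_response_vi y x' : X x' -> 0 <= dot (A *m y + mu *: br y) (x' - br y).
Proof.
move=> Xx'.
have := proj_obtuse (- (mu^-1 *: (A *m y))) Xcl (polyhedron_convex X_polytope.1) Xx'.
rewrite -/(br y) => H; rewrite -oppr_le0 -dotNl.
have -> : - (A *m y + mu *: br y) = mu *: (- (mu^-1 *: (A *m y)) - br y).
  by rewrite scalerBr scalerN scalerA mulfV ?scale1r ?gt_eqF // opprD.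
by rewrite dotZl pmulr_rle0.
Qed.

Lemma payoff_vi_le x y x' :
  0 <= dot (A *m y + mu *: x) (x' - x) ->
  L x y + mu / 2 * dot (x' - x) (x' - x) <= L x' y.
Proof. by rewrite [L x' y](payoff_addl _ _ x); lra. Qed.

Lemma payoff_vi_min x y x' :
  0 <= dot (A *m y + mu *: x) (x' - x) -> L x y <= L x' y.
Proof.
move=> /payoff_vi_le; apply: le_trans.
by rewrite lerDl mulr_ge0 ?dot_ge0 // divr_ge0 // ltW.
Qed.

Lemma min_payoff y : minimum [set L x y | x in X] = L (br y) y.
Proof.
apply: minimumE; first by exists (br y) => //; exact: best_response_in.
by move=> _ [x Xx <-]; apply/payoff_vi_min/best_response_vi.
Qed.

(** Lipschitz continuity of the dual function, stated for its opposite: the best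
    response to one strategy is a competitor against the other, and it ranges
    over a bounded set. *)
Lemma dual_lipschitz : exists K, forall u v,
  - L (br u) u - - L (br v) v <= K * norm2 (u - v).
Proof.
have [M XM] := X_polytope.2.
exists (spectral_norm A * M) => u v.
rewrite opprK addrC lerBlDl.
apply: le_trans (payoff_vi_min (best_response_vi v (best_response_in u))) _.
rewrite (payoff_addr _ _ _ u) lerD2l norm2_distC.
apply: le_trans (dot_mulmx_le _ _ _) _; rewrite ler_wpM2r ?norm2_ge0 //.
by rewrite ler_wpM2l ?spectral_norm_ge0 //; exact/XM/best_response_in.
Qed.

(** Danskin's theorem in disguise: the gradient at [y] of the dual function is
    [A^T *m br y], so it makes a nonpositive product with every feasible
    direction [e] at a maximizer. Concretely, optimality of [y] gives the
    inequality for the best response [xt] to [y + t *: e], and strong convexity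
    makes [xt] tend to [x] as [t] tends to 0. *)
Lemma saddle_best_response y :
    argmax_set Y (fun y => minimum [set L x y | x in X]) y ->
  saddle A X Y mu (br y) y.
Proof.
move=> [Yy ymax]; split=> // [|x'|y' Yy']; first exact: best_response_in.
  exact: best_response_vi.
have {}ymax b : Y b -> L (br b) b <= L (br y) y.
  by move=> Yb; have := ymax b Yb; rewrite /= !min_payoff.
have Yt t : 0 <= t -> t <= 1 -> Y (y + t *: (y' - y)).
  exact: polyhedron_convex Y_polytope.1 _ _ _ Yy Yy'.
move: (best_response_in y) (@best_response_vi y) ymax Yt.
move: (br y) (y' - y) => x e Xx vx ymax Yt.
rewrite leNgt; apply/negP => q0.
have N0 := dot_ge0 (A *m e).
(* For this t, the upper bound t / mu * dot (A *m e) (A *m e) that strong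
   convexity will give for dot (x - xt) (A *m e) is below dot x (A *m e). *)
have [t [t0 t1 tD]] : exists t, [/\ 0 < t, t <= 1 &
    t * (mu * dot x (A *m e) + dot (A *m e) (A *m e)) = mu * dot x (A *m e)].
  have mq : 0 < mu * dot x (A *m e) by apply: mulr_gt0.
  exists (mu * dot x (A *m e) / (mu * dot x (A *m e) + dot (A *m e) (A *m e))).
  by rewrite divfK ?divr_gt0 ?ler_pdivrMr ?mul1r ?lerDl ?gt_eqF ?ltr_pwDl.
have {}ymax := ymax _ (Yt t (ltW t0) t1).
move: (best_response_in (y + t *: e)) (@best_response_vi (y + t *: e)) ymax.
move: (br (y + t *: e)) => xt Xxt vxt ymax.
have xtA : dot xt (A *m e) <= 0.
  rewrite -(pmulr_rle0 _ t0) -dotZr scalemxAr -(gerDl (L xt y)).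
  have -> : L xt y + dot xt (A *m (t *: e)) = L xt (y + t *: e).
    by rewrite [RHS](payoff_addr _ _ _ y) [y + _]addrC addrK.
  exact: le_trans ymax (payoff_vi_min (vx _ Xxt)).
have mono : mu * dot (x - xt) (x - xt) <= t * dot (x - xt) (A *m e).
  move: (vx _ Xxt) (vxt _ Xx); rewrite mulmxDr -scalemxAr !dotE.
  rewrite (dotC xt x) !(dotC _ (A *m e)).
  by scalars => *; lra.
have qp : dot x (A *m e) <= dot (x - xt) (A *m e) by rewrite dotDl dotNl lerDl oppr_ge0.
have p0 := lt_le_trans q0 qp.
have cs : dot (x - xt) (A *m e) ^+ 2 <= dot (x - xt) (x - xt) * dot (A *m e) (A *m e).
  rewrite -!norm2_sqr -exprMn ler_sqr ?nnegrE ?(ltW p0) ?mulr_ge0 ?norm2_ge0 //.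
  exact: cauchy_schwarz.
move: mono cs qp p0 q0 N0 t0 tD.
move: (dot (x - xt) (x - xt)) (dot (x - xt) (A *m e)) (dot (A *m e) (A *m e)).
move: (dot x (A *m e)) => q D p N mono cs qp p0 q0 N0 t0 tD.
have : p * (mu * p) <= p * (t * N).
  by have := ler_wpM2l (ltW mu_gt0) cs; have := ler_wpM2r N0 mono; lra.
rewrite ler_pM2l // => mpN; have := ler_wpM2l (ltW mu_gt0) qp.
by have := mulr_gt0 t0 (mulr_gt0 mu_gt0 q0); lra.
Qed.

Lemma saddle_exists : exists x y, saddle A X Y mu x y.
Proof.
have [K hK] := dual_lipschitz; have [M YM] := Y_polytope.2.
have [y [Yy ymax]] := attained_min Ycl YM Y_nonempty hK.
exists (br y), y; apply: saddle_best_response; split=> // b Yb.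
by rewrite !min_payoff -lerN2; apply: ymax.
Qed.

(** At a saddle point the worst payoff of [x] is [L x y], while that of any other
    [x'] is at least [L x' y], which is larger by the strong convexity of [L] in
    its first argument; so [x] is the only minimizer. *)
Lemma minimax_strategy_saddle x y : saddle A X Y mu x y -> minimax_strategy A X Y mu = x.
Proof.
move=> [Xx Yy vx vy].
have [M YM] := Y_polytope.2.
have gx : maximum [set L x y | y in Y] = L x y.
  apply: maximumE; first by exists y.
  by move=> _ [y' Yy' <-]; rewrite [L x y'](payoff_addr _ _ _ y) gerDl vy.
have gx' x' : L x' y <= maximum [set L x' y | y in Y].
  have [u v|w [Yw wmax]] := @attained_min _ _ Y (fun y => - L x' y)
    (norm2 (A^T *m x')) M Ycl YM Y_nonempty.
    rewrite (payoff_addr _ _ _ u v) opprK addKr -dot_mulmx.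
    by rewrite norm2_distC cauchy_schwarz.
  rewrite (@maximumE _ _ (L x' w)); first by rewrite -lerN2 wmax.
    by exists w.
  by move=> _ [b Yb <-]; rewrite -lerN2 wmax.
apply: xget_subset1.
  split=> // x' Xx'; rewrite gx; apply: le_trans (gx' x').
  exact: payoff_vi_min (vx _ Xx').
suff H x' : argmin_set X (fun x => maximum [set L x y | y in Y]) x' -> x' = x.
  by move=> a b /H -> /H ->.
move=> [Xx' /(_ _ Xx)]; rewrite gx => H.
apply/eqP; rewrite -subr_eq0; apply/eqP/dot_eq0/eqP; rewrite eq_le dot_ge0 andbT.
have := payoff_vi_le (vx _ Xx'); have := gx' x'.
rewrite -(@pmulr_rle0 _ (mu / 2)); last by rewrite divr_gt0.
lra.
Qed.

(** The equilibria form a product because all saddle points share their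
    x-component, the minimax strategy. *)
Lemma equilibriaP z :
  equilibria A X Y mu z <-> saddle A X Y mu (usubmx z) (dsubmx z).
Proof.
split=> [[/= -> ymax]|sad].
  have sad := saddle_best_response ymax.
  by rewrite (minimax_strategy_saddle sad).
split; first by rewrite /= (minimax_strategy_saddle sad).
have [Xx Yy vx vy] := sad; split=> // y' Yy'; rewrite !min_payoff.
apply: le_trans (payoff_vi_min (best_response_vi y' Xx)) _.
rewrite (payoff_addr _ _ _ (dsubmx z)).
apply: le_trans (_ : L (usubmx z) (dsubmx z) <= _); first by rewrite gerDl vy.
by apply/payoff_vi_min/vx/best_response_in.
Qed.

Lemma equilibria_closed : closed (equilibria A X Y mu).
Proof.
apply: prod_set_closed.
  apply: compact_closed; last exact: compact_set1.
  exact: norm_hausdorff.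
have [x0 [y0 sad0]] := saddle_exists.
have [K hK] := dual_lipschitz.
have [y [Yy ymax]] : exists y, argmax_set Y (fun y => minimum [set L x y | x in X]) y.
  have /equilibriaP[_ H] :
      saddle A X Y mu (usubmx (col_mx x0 y0)) (dsubmx (col_mx x0 y0)).
    by rewrite col_mxKu col_mxKd.
  by eexists; exact: H.
rewrite (_ : maximin_strategies _ _ _ _ =
    Y `&` (fun y => - L (br y) y) @^-1` [set r | r <= - L (br y) y]).
  apply: closedI => //; apply: preimage_closed => [u _|]; last exact: closed_le.
  exact: lipschitz_continuous hK _.
apply/seteqP; split=> [u [Yu umax]|u [Yu uy]].
  by split=> //; have := umax _ Yy; rewrite !min_payoff -lerN2.
split=> // b Yb; apply: le_trans (ymax b Yb) _.
by rewrite !min_payoff -lerN2.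
Qed.

Lemma equilibria_nonempty : equilibria A X Y mu !=set0.
Proof.
have [x [y sad]] := saddle_exists; exists (col_mx x y).
by apply/equilibriaP; rewrite col_mxKu col_mxKd.
Qed.

End Saddle.

(** * The error bound *)

(** By the inequality of the means, [2 * (H * r)] is at most
    [H ^+ 2 / mu * N + d], so half of [d] can be absorbed. *)
Lemma quadratic_bound (R : realType) (mu H N r d : R) :
    0 < mu -> 0 <= H -> 0 <= N -> 0 <= r -> 0 <= d ->
    d <= H * (N + r) -> mu * r ^+ 2 <= N * d ->
  d <= (2 * H + H ^+ 2 / mu) * N.
Proof.
move=> mu0 H0 N0 r0 d0 dH rd.
pose u := H ^+ 2 / mu * N.
have u0 : 0 <= u by rewrite mulr_ge0 ?divr_ge0 ?sqr_ge0 ?(ltW mu0).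
have Hr : (H * r) ^+ 2 <= u * d.
  have -> : u * d = H ^+ 2 / mu * (N * d) by rewrite mulrA.
  have -> : (H * r) ^+ 2 = H ^+ 2 / mu * (mu * r ^+ 2) by field; rewrite gt_eqF.
  by rewrite ler_wpM2l // divr_ge0 ?sqr_ge0 // ltW.
have : 2 * (H * r) <= u + d.
  have Hr0 := mulr_ge0 H0 r0; rewrite -ler_sqr ?nnegrE; [|lra|lra].
  by have := sqr_ge0 (u - d); lra.
by move=> Hrud; rewrite mulrDl -/u; lra.
Qed.

Section ErrorBound.

Context (R : realType) (m n : nat) (A : 'M[R]_(m, n)).
Context (X : set 'cV[R]_m) (Y : set 'cV[R]_n) (mu : R).

Local Notation a := (spectral_norm A).

(** Monotonicity of the game operator, strong in the x-component only: adding
    the variational inequality at the saddle point and the approximate one at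
    [(x, y)], the bilinear terms cancel. *)
Lemma residual_gap x0 y0 x y vx vy :
    saddle A X Y mu x0 y0 -> X x -> Y y ->
    normal_cone X x vx -> normal_cone Y y vy ->
  mu * norm2 (x - x0) ^+ 2 <=
  norm2 (col_mx (A *m y + mu *: x + vx) (- (A^T *m x) + vy)) *
  norm2 (col_mx x y - col_mx x0 y0).
Proof.
move=> [Xx0 Yy0 sx sy] Xx Yy Nx Ny; apply: le_trans (cauchy_schwarz _ _).
rewrite opp_col_mx add_col_mx dot_col_mx norm2_sqr.
move: (sx _ Xx) (sy _ Yy) (Nx _ Xx0) (Ny _ Yy0).
rewrite !mulmxBr !dotE !dot_mulmx.
rewrite (dotC x0 x) !(dotC _ (A *m y)) !(dotC _ (A *m y0)).
by scalars => *; lra.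
Qed.

(** For the fixed [x0], the condition that [(x0, y)] is a saddle point is a system
    of linear inequalities in [y] and in multipliers [l] that exhibit
    [- (A *m y + mu *: x0)] as a normal vector of the polyhedron [X] at [x0]:
    feasibility of [y], optimality of [y] against [x0], nonnegativity of [l],
    stationarity, and complementary slackness, which is linear since [x0] is
    fixed. Hoffman's bound applies to this system. *)
Lemma saddle_hoffman p (B : 'M[R]_(p, m)) (b : 'cV[R]_p) x0 y0 :
    X = [set x | forall i, (B *m x) i ord0 <= b i ord0] -> polyhedron Y ->
    saddle A X Y mu x0 y0 ->
  exists2 K, 0 <= K & forall y (l : 'cV[R]_p) r,
    0 <= r -> Y y -> (forall i, 0 <= l i ord0) ->
    dot x0 (A *m (y0 - y)) <= r ->
    (forall j, `|(A *m y + mu *: x0 + B^T *m l) j ord0| <= r) ->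
    dot l (b - B *m x0) <= r ->
    exists2 y', saddle A X Y mu x0 y' & norm2 (y' - y) <= K * r.
Proof.
move=> XE [q [C [e YE]]] sad0; have [Xx0 Yy0 sx0 sy0] := sad0.
(* Optimality and complementarity are single inequalities, indexed by true and
   false; each stationarity equation is a pair of opposite inequalities. *)
pose c (i : 'I_q + 'I_p + ('I_m * bool + bool)) : 'cV[R]_(n + p) :=
  match i with
  | inl (inl i) => col_mx (row i C)^T 0
  | inl (inr i) => col_mx 0 (- delta_mx i ord0)
  | inr (inl (j, s)) => (-1) ^+ s *: col_mx (row j A)^T (row j B^T)^T
  | inr (inr true) => col_mx (- (A^T *m x0)) 0
  | inr (inr false) => col_mx 0 (b - B *m x0)
  end.
pose d (i : 'I_q + 'I_p + ('I_m * bool + bool)) : R :=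
  match i with
  | inl (inl i) => e i ord0
  | inl (inr i) => 0
  | inr (inl (j, s)) => - ((-1) ^+ s * (mu * x0 j ord0))
  | inr (inr true) => - dot x0 (A *m y0)
  | inr (inr false) => 0
  end.
have cP y l r : (forall i, dot (c i) (col_mx y l) <= d i + r) <->
  [/\ forall i, (C *m y) i ord0 <= e i ord0 + r, forall i, - r <= l i ord0,
      forall j, `|(A *m y + mu *: x0 + B^T *m l) j ord0| <= r,
      dot x0 (A *m (y0 - y)) <= r & dot l (b - B *m x0) <= r].
  have dj j s : (dot (c (inr (inl (j, s)))) (col_mx y l) <= d (inr (inl (j, s))) + r) =
      ((-1) ^+ s * (A *m y + mu *: x0 + B^T *m l) j ord0 <= r).
    rewrite /c /d dotZl dot_col_mx !dot_row -lerBlDl opprK -mulrDr addrAC.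
    by rewrite [in RHS]mxE [(A *m y + mu *: x0) j ord0]mxE [(mu *: x0) j ord0]mxE.
  have dt : (dot (c (inr (inr true))) (col_mx y l) <= d (inr (inr true)) + r) =
      (dot x0 (A *m (y0 - y)) <= r).
    rewrite /c /d dot_col_mx dot0l addr0 dotNl dot_mulmx mulmxBr dotDr dotNr.
    by rewrite -lerBlDl opprK addrC.
  have di i : dot (c (inl (inr i))) (col_mx y l) = - l i ord0.
    rewrite /c dot_col_mx dot0l add0r dotNl /dot (bigD1 i) //=.
    rewrite big1 ?mxE ?eqxx ?mul1r ?addr0 //.
    by move=> k /negbTE ki; rewrite mxE ki mul0r.
  have df : dot (c (inr (inr false))) (col_mx y l) = dot l (b - B *m x0).
    by rewrite /c dot_col_mx dot0l add0r dotC.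
  have dl i : dot (c (inl (inl i))) (col_mx y l) = (C *m y) i ord0.
    by rewrite /c dot_col_mx dot0l addr0 dot_row.
  split=> [H|[H1 H2 H3 H4 H5]].
    split.
    - by move=> i; rewrite -dl; exact: (H (inl (inl i))).
    - by move=> i; have := H (inl (inr i)); rewrite di lerNl /d add0r.
    - move=> j; have := H (inr (inl (j, false))); have := H (inr (inl (j, true))).
      by rewrite !dj expr0 expr1 mul1r mulN1r ler_norml lerNl => -> ->.
    - by rewrite -dt; exact: H.
    - by have := H (inr (inr false)); rewrite df /d add0r.
  case=> [[i|i]|[[j s]|[|]]].
  - by rewrite dl; exact: H1.
  - by rewrite di /d add0r lerNl.
  - rewrite dj; have := H3 j; rewrite ler_norml => /andP[H6 H7].
    by case: s; rewrite ?expr0 ?expr1 ?mul1r // mulN1r lerNl.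
  - by rewrite dt.
  - by rewrite df /d add0r.
have [K K0 HK] := hoffman c; exists K => // y l r r0 Yy l0 y_opt stat compl.
have [||w wc wy] := HK d _ (col_mx y l) r r0.
- have Nv0 : normal_cone X x0 (- (A *m y0 + mu *: x0)).
    by move=> x' Xx'; rewrite dotNl oppr_le0 sx0.
  rewrite XE in Xx0 Nv0; have [l' [l'0 l'B l'c]] := normal_cone_polyhedron Xx0 Nv0.
  exists (col_mx y0 l') => i; rewrite -[d i]addr0; move: i; apply/cP; split.
  + by move=> i; move: Yy0; rewrite YE addr0; apply.
  + by move=> i; rewrite oppr0.
  + by move=> j; rewrite l'B subrr mxE normr0.
  + by rewrite subrr mulmx0 dotC dot0l.
  + by rewrite l'c.
- apply/cP; split=> // i; last by apply: le_trans (l0 i); rewrite oppr_le0.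
  by move: Yy; rewrite YE => /(_ i) Yi; apply: le_trans Yi _; rewrite lerDl.
have {}wc : forall i, dot (c i) (col_mx (usubmx w) (dsubmx w)) <= d i + 0.
  by move=> i; rewrite vsubmxK addr0.
move/cP: wc => [w1 w2 w3 w4 w5].
exists (usubmx w); last first.
  apply: le_trans wy; rewrite -{2}(vsubmxK w) opp_col_mx add_col_mx.
  exact: norm2_usubmx_le.
split=> //.
- by rewrite YE => i; have := w1 i; rewrite addr0.
- move=> x' Xx'.
  have -> : A *m usubmx w + mu *: x0 = - (B^T *m dsubmx w).
    apply/colP => j; have := w3 j; rewrite normr_le0 => /eqP.
    by rewrite [in X in X -> _]mxE => /eqP; rewrite addr_eq0 => /eqP ->; rewrite [RHS]mxE.
  rewrite dotNl oppr_ge0 dot_mulmx.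
  have -> : B *m (x' - x0) = (B *m x' - b) + (b - B *m x0).
    by rewrite mulmxBr addrA subrK.
  rewrite dotDr -[leRHS]addr0; apply: lerD => //.
  apply: sumr_le0 => i _; rewrite mulr_ge0_le0 //; first by rewrite -oppr0.
  by rewrite mxE [X in _ + X]mxE subr_le0; move: Xx'; rewrite XE; apply.
- move=> y' Yy'; have -> : y' - usubmx w = (y' - y0) + (y0 - usubmx w).
    by rewrite addrA subrK.
  by rewrite mulmxDr dotDr -[leRHS]addr0; apply: lerD => //; exact: sy0.
Qed.

(** The multipliers of [x] nearly satisfy the system of [saddle_hoffman] for
    [x0], up to the residual plus the distance from [x] to [x0]. This bounds the
    distance to a saddle point [(x0, y')] by a multiple of that sum, and the
    distance in the x-component is of the order of the square root of the
    residual times the distance to [(x0, y')], by [residual_gap]. The two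
    estimates combine into a linear bound by [quadratic_bound]. *)
Lemma error_bound :
    polytope X -> polytope Y -> X !=set0 -> Y !=set0 -> 0 < mu ->
  exists2 c, 0 < c & forall x y vx vy,
    X x -> Y y -> normal_cone X x vx -> normal_cone Y y vy ->
    exists2 z', equilibria A X Y mu z' &
      norm2 (col_mx x y - z') <=
      c * norm2 (col_mx (A *m y + mu *: x + vx) (- (A^T *m x) + vy)).
Proof.
move=> Xp Yp X0 Y0 mu0.
have [x0 [y0 sad0]] := saddle_exists A Xp Yp X0 Y0 mu0.
have [Xx0 Yy0 sx0 sy0] := sad0.
have [[p [B [b XE]]] [MX XM]] := Xp; have [_ [MY YM]] := Yp.
have [K K0 HK] := saddle_hoffman XE Yp.1 sad0.
have a0 := spectral_norm_ge0 A.
have MX0 : 0 <= MX := le_trans (norm2_ge0 _) (XM _ Xx0).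
have MY0 : 0 <= MY := le_trans (norm2_ge0 _) (YM _ Yy0).
have [G [G1 Gmu GY GaY Gxy]] : exists G, [/\ 1 <= G, mu <= G, MY + MY <= G,
    a * (MY + MY) <= G & MX + MX + (a * MY + mu * MX) <= G].
  exists (1 + mu + (MX + MX) + (MY + MY) + a * (MY + MY) + (a * MY + mu * MX)).
  have := mulr_ge0 a0 MY0; have := mulr_ge0 (ltW mu0) MX0.
  by split; lra.
have G0 : 0 <= G by apply: le_trans G1.
have GX : MX + MX <= G.
  by apply: le_trans Gxy; rewrite lerDl addr_ge0 ?mulr_ge0 ?(ltW mu0).
have Gx : a * MY + mu * MX <= G.
  by apply: le_trans Gxy; rewrite lerDr addr_ge0.
pose H := 1 + K * G; have H1 : 1 <= H by rewrite lerDl mulr_ge0.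
have H0 : 0 < H by apply: lt_le_trans H1.
exists (2 * H + H ^+ 2 / mu).
  by rewrite addr_gt0 ?mulr_gt0 ?invr_gt0 ?exprn_gt0.
move=> x y vx vy Xx Yy Nx Ny.
set rx := A *m y + mu *: x + vx; set ry := - (A^T *m x) + vy.
pose N := norm2 (col_mx rx ry); pose r := norm2 (x - x0).
have N0 : 0 <= N by apply: norm2_ge0.
have r0 : 0 <= r by apply: norm2_ge0.
have rxN : norm2 rx <= N by apply: norm2_usubmx_le.
have ryN : norm2 ry <= N by apply: norm2_dsubmx_le.
have G_le s t : s <= G -> t <= G -> s * N + t * r <= G * (N + r).
  by move=> sG tG; rewrite mulrDr lerD // ler_wpM2r.
have vxE : vx = rx - (A *m y + mu *: x) by rewrite /rx addrC addKr.
have vyE : vy = ry + A^T *m x by rewrite /ry addrC addrA subrr add0r.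
have dx : norm2 (x - x0) <= MX + MX.
  by apply: le_trans (norm2D _ _) _; rewrite norm2N lerD ?XM.
have dy : norm2 (y0 - y) <= MY + MY.
  by apply: le_trans (norm2D _ _) _; rewrite norm2N lerD ?YM.
have Xx' := Xx; have Nx' := Nx; rewrite XE in Xx' Nx'.
have [l [l0 lB lc]] := normal_cone_polyhedron Xx' Nx'.
have [||||y' sad' y'y] := HK y l (G * (N + r)) _ Yy l0.
- by rewrite mulr_ge0 ?addr_ge0.
- have -> : dot x0 (A *m (y0 - y)) =
      dot vy (y0 - y) + dot (- ry) (y0 - y) + dot (- (x - x0)) (A *m (y0 - y)).
    by rewrite vyE -dotDl addrAC subrr add0r dot_mulmx -dotDl opprB [x + _]addrC subrK.
  apply: le_trans (G_le _ _ GY GaY); rewrite -[leRHS]add0r addrA.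
  apply: lerD; first apply: lerD; first exact: Ny.
    apply: le_trans (cauchy_schwarz _ _) _.
    by rewrite norm2N mulrC ler_pM ?norm2_ge0.
  apply: le_trans (dot_mulmx_le _ _ _) _.
  rewrite norm2N -/r mulrAC; apply: ler_wpM2r => //.
  exact: ler_wpM2l.
- move=> j; apply: le_trans (norm2_coord_le _ _) _.
  have -> : A *m y + mu *: x0 + B^T *m l = rx - mu *: (x - x0).
    rewrite lB vxE scalerBr opprB [LHS]addrC -[LHS]addrA opprD.
    congr (_ + _); rewrite addrACA addNr add0r.
    by rewrite [- _ + _]addrC.
  apply: le_trans (norm2D _ _) _; rewrite norm2N norm2Z (gtr0_norm mu0) -/r.
  by apply: le_trans (G_le _ _ G1 Gmu); rewrite mul1r lerD2r.
- have -> : b - B *m x0 = (b - B *m x) + B *m (x - x0).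
    by rewrite mulmxBr addrA subrK.
  rewrite dotDr lc add0r -dot_mulmx lB vxE dotDl dotNl -dotNr opprB.
  apply: le_trans (G_le _ _ GX Gx).
  apply: lerD.
    apply: le_trans (cauchy_schwarz _ _) _.
    by rewrite mulrC ler_pM ?norm2_ge0.
  rewrite dotDl dotZl dotC mulrDl; apply: lerD.
    apply: le_trans (dot_mulmx_le _ _ _) _; rewrite norm2_distC -/r mulrAC.
    by rewrite ler_wpM2r // ler_wpM2l // YM.
  rewrite -mulrA ler_pM2l //; apply: le_trans (cauchy_schwarz _ _) _.
  by rewrite norm2_distC ler_wpM2r // XM.
exists (col_mx x0 y').
  by apply/equilibriaP => //; rewrite col_mxKu col_mxKd.
have gap := residual_gap sad' Xx Yy Nx Ny.
apply: quadratic_bound gap => //; [exact: ltW|exact: norm2_ge0|].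
rewrite opp_col_mx add_col_mx; apply: le_trans (norm2_col_mx_le _ _) _.
rewrite (norm2_distC y) -/N -/r /H mulrDl mul1r -mulrA.
by apply: lerD y'y; rewrite lerDr.
Qed.

End ErrorBound.

(** * Alternating gradient descent-ascent *)

(** The left side is a concave quadratic in [E], whose maximum is
    [eta / (2 * mu)] times the square of [a * q + mu * p]. The restriction on the
    learning rate is what Cauchy-Schwarz then requires for the constant 1/2. *)
Lemma young_step (R : realType) (a mu eta E p q : R) :
    0 < mu -> 0 < eta -> eta * (mu ^+ 2 + a ^+ 2) <= mu ->
  2 * eta * (a * E * q + mu * (p * E) - mu * E ^+ 2) <= (p ^+ 2 + q ^+ 2) / 2.
Proof.
move=> mu0 eta0 le_mu.
pose w := a * q + mu * p.
have ew : eta * w ^+ 2 <= mu * (p ^+ 2 + q ^+ 2).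
  apply: (@le_trans _ _ (eta * ((mu ^+ 2 + a ^+ 2) * (p ^+ 2 + q ^+ 2)))).
    rewrite ler_pM2l // /w; have := sqr_ge0 (a * p - mu * q); lra.
  by rewrite mulrA ler_wpM2r // addr_ge0 ?sqr_ge0.
have sq : 0 <= eta * (2 * mu * E - w) ^+ 2 by rewrite mulr_ge0 ?sqr_ge0 // ltW.
rewrite -(ler_pM2l mu0); rewrite /w in ew sq; lra.
Qed.

Section Descent.

Context (R : realType) (m n : nat) (A : 'M[R]_(m, n)).
Context (X : set 'cV[R]_m) (Y : set 'cV[R]_n) (mu eta : R).
Context (X_polytope : polytope X) (Y_polytope : polytope Y).
Context (mu_gt0 : 0 < mu) (eta_gt0 : 0 < eta).

Local Notation a := (spectral_norm A).

Context (eta_le : eta <= mu / (mu ^+ 2 + a ^+ 2)).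

Let d_gt0 : 0 < mu ^+ 2 + a ^+ 2.
Proof. by rewrite ltr_pwDl ?exprn_gt0 ?sqr_ge0. Qed.

(** The obtuse angle inequalities of both projections are added to the
    variational inequality at the saddle point. Since [y'] is computed from the
    new [x'], the bilinear terms cancel up to the coupling
    [dot (x' - x0) (A *m (y' - y))]; with the drift [dot (x' - x) (x' - x0)] it
    is compensated by the strong convexity in [x], see [young_step]. *)
Lemma step_descent x0 y0 x y
    (x' := proj X (x - eta *: (A *m y + mu *: x)))
    (y' := proj Y (y + eta *: (A^T *m x'))) :
    saddle A X Y mu x0 y0 -> X x -> Y y ->
  norm2 (col_mx x' y' - col_mx x0 y0) ^+ 2 +
    norm2 (col_mx x y - col_mx x' y') ^+ 2 / 2 <=
  norm2 (col_mx x y - col_mx x0 y0) ^+ 2.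
Proof.
move=> [Xx0 Yy0 sx sy] Xx Yy.
have Xcl := polyhedron_closed X_polytope.1; have Ycl := polyhedron_closed Y_polytope.1.
have Xx' : X x' by apply: proj_in => //; exists x.
have Yy' : Y y' by apply: proj_in => //; exists y.
have ox : dot (x - eta *: (A *m y + mu *: x) - x') (x0 - x') <= 0.
  exact: proj_obtuse Xcl (polyhedron_convex X_polytope.1) Xx0.
have oy : dot (y + eta *: (A^T *m x') - y') (y0 - y') <= 0.
  exact: proj_obtuse Ycl (polyhedron_convex Y_polytope.1) Yy0.
move: (sx _ Xx') (sy _ Yy') ox oy => {sx sy}.
move: x' y' Xx' Yy' => x' y' _ _ sx sy ox oy.
have {}sx := mulr_ge0 (ltW eta_gt0) sx.
have {}sy := ler_wpM2l (ltW eta_gt0) sy; rewrite mulr0 in sy.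
have le_mu : eta * (mu ^+ 2 + a ^+ 2) <= mu by rewrite -ler_pdivlMr.
have := young_step (norm2 (x' - x0)) (norm2 (x - x')) (norm2 (y - y'))
  mu_gt0 eta_gt0 le_mu.
have coup : dot (x' - x0) (A *m (y' - y)) <= a * norm2 (x' - x0) * norm2 (y - y').
  by rewrite (norm2_distC y); exact: dot_mulmx_le.
have drift : dot (x' - x) (x' - x0) <= norm2 (x - x') * norm2 (x' - x0).
  by rewrite (norm2_distC x); exact: cauchy_schwarz.
have {coup drift} : 2 * eta * (dot (x' - x0) (A *m (y' - y)) +
      mu * dot (x' - x) (x' - x0) - mu * dot (x' - x0) (x' - x0)) <=
    2 * eta * (a * norm2 (x' - x0) * norm2 (y - y') +
      mu * (norm2 (x - x') * norm2 (x' - x0)) - mu * norm2 (x' - x0) ^+ 2).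
  apply: ler_wpM2l; first by rewrite mulr_ge0 // ltW.
  by rewrite norm2_sqr lerD2r lerD // ler_pM2l.
move=> /le_trans h /h {h}.
rewrite !opp_col_mx !add_col_mx !norm2_sqr !dot_col_mx.
move: sx sy ox oy; rewrite !mulmxBr !dotE !dot_mulmx.
rewrite (dotC x0 x) (dotC x' x) (dotC x' x0) (dotC y0 y) (dotC y' y) (dotC y' y0).
rewrite !(dotC _ (A *m y)) !(dotC _ (A *m y')) !(dotC _ (A *m y0)).
by scalars => *; lra.
Qed.

(** The displacements of the two projections are normal vectors at the new
    point; divided by [eta], they give a residual there that is at most the
    length of the step over [eta], plus the change of the gradients between the
    old point and the new one. *)
Lemma step_residual x y
    (x' := proj X (x - eta *: (A *m y + mu *: x)))
    (y' := proj Y (y + eta *: (A^T *m x'))) :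
    X x -> Y y ->
  exists vx vy, [/\ X x', Y y', normal_cone X x' vx, normal_cone Y y' vy &
    eta * norm2 (col_mx (A *m y' + mu *: x' + vx) (- (A^T *m x') + vy)) <=
    (1 + eta * (mu + a)) * norm2 (col_mx x y - col_mx x' y')].
Proof.
move=> Xx Yy.
have Xcl := polyhedron_closed X_polytope.1; have Ycl := polyhedron_closed Y_polytope.1.
exists (eta^-1 *: (x - eta *: (A *m y + mu *: x) - x')).
exists (eta^-1 *: (y + eta *: (A^T *m x') - y')); split.
- by apply: proj_in => //; exists x.
- by apply: proj_in => //; exists y.
- move=> s Xs; rewrite dotZl pmulr_rle0 ?invr_gt0 //.
  exact: proj_obtuse Xcl (polyhedron_convex X_polytope.1) Xs.
- move=> s Ys; rewrite dotZl pmulr_rle0 ?invr_gt0 //.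
  exact: proj_obtuse Ycl (polyhedron_convex Y_polytope.1) Ys.
rewrite -{1}(gtr0_norm eta_gt0) -norm2Z scale_col_mx.
have eta_neq0 : eta != 0 by rewrite gt_eqF.
have -> : col_mx
    (eta *: (A *m y' + mu *: x' + eta^-1 *: (x - eta *: (A *m y + mu *: x) - x')))
    (eta *: (- (A^T *m x') + eta^-1 *: (y + eta *: (A^T *m x') - y'))) =
  (col_mx x y - col_mx x' y')
  - eta *: (mu *: col_mx (x - x') 0 + col_mx (A *m (y - y')) 0).
  rewrite opp_col_mx add_col_mx !scale_col_mx !add_col_mx !scale_col_mx.
  rewrite opp_col_mx add_col_mx !(scalerDr, scalerA, mulfV eta_neq0, scale1r, mulmxBr).
  congr col_mx; apply/matrixP => i j; rewrite !mxE.
    by move: ((A *m y) i j) ((A *m y') i j) => *; ring.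
  by move: ((A^T *m x') i j) => *; ring.
set dz := col_mx x y - col_mx x' y'.
have dzE : dz = col_mx (x - x') (y - y') by rewrite /dz opp_col_mx add_col_mx.
apply: le_trans (norm2D _ _) _; rewrite norm2N norm2Z (gtr0_norm eta_gt0).
rewrite mulrDl mul1r lerD2l -mulrA ler_pM2l // mulrDl.
have colmx0 k (u : 'cV[R]_k) : norm2 (col_mx u (0 : 'cV[R]_n)) = norm2 u.
  by rewrite /norm2 dot_col_mx dot0l addr0.
apply: le_trans (norm2D _ _) _; rewrite norm2Z (gtr0_norm mu_gt0) !colmx0 dzE.
apply: lerD; first by rewrite ler_pM2l // norm2_usubmx_le.
apply: le_trans (spectral_norm_bound _ _) _.
by rewrite ler_wpM2l ?spectral_norm_ge0 // norm2_dsubmx_le.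
Qed.

End Descent.

(** * Linear convergence *)

Lemma normal_cone_closed (R : realType) k (C : set 'cV[R]_k) z :
  closed (normal_cone C z).
Proof.
rewrite (_ : normal_cone C z =
    [set v | forall p : {z' | C z'}, dot (sval p - z) v <= 0]).
  exact: closed_halfspaces.
apply/seteqP; split=> v /= H; first by case=> z' Cz' /=; rewrite dotC H.
by move=> z' Cz'; rewrite dotC; exact: (H (exist _ z' Cz')).
Qed.

Lemma normal_cone_prod (R : realType) m n (X : set 'cV[R]_m) (Y : set 'cV[R]_n) z v :
    prod_set X Y z -> normal_cone (prod_set X Y) z v ->
  normal_cone X (usubmx z) (usubmx v) /\ normal_cone Y (dsubmx z) (dsubmx v).
Proof.
move=> [Xz Yz] Nv.
have Nv' x y : X x -> Y y ->
    dot (usubmx v) (x - usubmx z) + dot (dsubmx v) (y - dsubmx z) <= 0.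
  move=> Xx Yy; rewrite -dot_col_mx vsubmxK -add_col_mx -opp_col_mx vsubmxK.
  by apply: Nv; split; rewrite ?col_mxKu ?col_mxKd.
split=> [x Xx|y Yy].
  by have := Nv' _ _ Xx Yz; rewrite subrr [X in _ + X]dotC dot0l addr0.
by have := Nv' _ _ Xz Yy; rewrite subrr [X in X + _]dotC dot0l add0r.
Qed.

Lemma beta_mu_gt0 (R : realType) m n (A : 'M[R]_(m, n)) mu c :
  0 < mu -> 0 < c -> 0 < beta_mu A mu c.
Proof.
move=> mu0 c0; rewrite /beta_mu /=.
have a0 := spectral_norm_ge0 A.
have d0 : 0 < mu ^+ 2 + spectral_norm A ^+ 2 by rewrite ltr_pwDl ?exprn_gt0 ?sqr_ge0.
apply: mulr_gt0; last by rewrite ltr_pwDl // divr_ge0 ?mulr_ge0 // ltW.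
rewrite addr_gt0 ?divr_gt0 // mulr_gt0 // ltr_pwDl // divr_ge0 ?(ltW d0) //.
by rewrite mulr_ge0 ?addr_ge0 // ltW.
Qed.

Lemma beta_mu_ge (R : realType) m n (A : 'M[R]_(m, n)) mu c eta :
    0 < mu -> 0 < c -> eta <= mu / (mu ^+ 2 + spectral_norm A ^+ 2) ->
  c * (1 + eta * (mu + spectral_norm A)) <= beta_mu A mu c.
Proof.
move=> mu0 c0 eta_le; rewrite /beta_mu /=.
set a := spectral_norm A in eta_le *; set d := mu ^+ 2 + a ^+ 2 in eta_le *.
have a0 : 0 <= a := spectral_norm_ge0 A.
have d0 : 0 < d by rewrite ltr_pwDl ?exprn_gt0 ?sqr_ge0.
have muad : 0 <= mu * (mu + a) / d.
  by rewrite divr_ge0 ?(ltW d0) // mulr_ge0 ?addr_ge0 // ltW.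
apply: (@le_trans _ _ (c * (1 + mu * (mu + a) / d))).
  rewrite ler_pM2l // lerD2l mulrAC; apply: ler_wpM2r => //.
  by rewrite addr_ge0 // ltW.
apply: (@le_trans _ _ (mu / d + c * (1 + mu * (mu + a) / d))).
  by rewrite lerDr divr_ge0 // ltW.
apply: ler_peMr; last by rewrite lerDl divr_ge0 ?mulr_ge0 // ltW.
rewrite addr_ge0 ?divr_ge0 ?(ltW mu0) ?(ltW d0) //.
by rewrite mulr_ge0 ?(ltW c0) // addr_ge0.
Qed.

(** With [D] and [D'] the distances before and after a step of length [N]: the
    error bound makes [N] at least [eta / beta * D'], so that the decrease of the
    squared distance is a fixed fraction of its new value. *)
Lemma contraction (R : realType) (eta beta D D' N : R) :
    0 < eta -> 0 < beta -> 0 <= D' -> eta * D' <= beta * N ->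
    D' ^+ 2 + N ^+ 2 / 2 <= D ^+ 2 ->
  D' ^+ 2 <= 1 / (1 + eta ^+ 2 / (2 * beta ^+ 2)) * D ^+ 2.
Proof.
move=> eta0 beta0 D'0 D'N desc.
have q0 : 0 < 1 + eta ^+ 2 / (2 * beta ^+ 2).
  by rewrite ltr_pwDl // (divr_ge0 (sqr_ge0 _) (mulr_ge0 (ler0n _ 2) (sqr_ge0 _))).
rewrite mul1r mulrC ler_pdivlMr //; apply: le_trans desc.
rewrite mulrDr mulr1 lerD2l mulrA ler_pdivrMr ?mulr_gt0 ?exprn_gt0 //.
have -> : N ^+ 2 / 2 * (2 * beta ^+ 2) = (beta * N) ^+ 2 by field.
have eD'0 : 0 <= eta * D' by rewrite mulr_ge0 // ltW.
by rewrite -exprMn [D' * _]mulrC ler_sqr // nnegrE (le_trans eD'0).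
Qed.

Theorem theorem4p1 (R : realType) (m n : nat) (A : 'M[R]_(m, n))
  (X : set 'cV[R]_m) (Y : set 'cV[R]_n) (mu : R)
  (X_polytope : polytope X) (Y_polytope : polytope Y)
  (X_nonempty : X !=set0) (Y_nonempty : Y !=set0) (mu_gt0 : 0 < mu) :
  exists c : R,
    [/\ 0 < c,
        (forall z : 'cV[R]_(m + n), prod_set X Y z ->
          dist z (equilibria A X Y mu) <=
          c * minimum [set norm2 (F_mu A mu z + v)
                      | v in normal_cone (prod_set X Y) z]),
        0 < beta_mu A mu c &
        forall eta : R,
          0 < eta -> eta <= mu / (mu ^+ 2 + spectral_norm A ^+ 2) ->
          forall (x : nat -> 'cV[R]_m) (y : nat -> 'cV[R]_n),
            X (x 1%N) -> Y (y 1%N) -> AsymP_GDA A X Y mu eta x y ->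
            forall t : nat, (1 <= t)%N ->
              dist (col_mx (x t) (y t)) (equilibria A X Y mu) ^+ 2 <=
              (1 / (1 + eta ^+ 2 / (2 * beta_mu A mu c ^+ 2))) ^+ (t - 1) *
              dist (col_mx (x 1%N) (y 1%N)) (equilibria A X Y mu) ^+ 2].
Proof.
have [c c0 eb] := error_bound A X_polytope Y_polytope X_nonempty Y_nonempty mu_gt0.
have Ecl : closed (equilibria A X Y mu) by apply: equilibria_closed.
have E0 : equilibria A X Y mu !=set0 by apply: equilibria_nonempty.
have dist_eb x y vx vy : X x -> Y y -> normal_cone X x vx -> normal_cone Y y vy ->
    dist (col_mx x y) (equilibria A X Y mu) <=
    c * norm2 (col_mx (A *m y + mu *: x + vx) (- (A^T *m x) + vy)).
  move=> Xx Yy Nx Ny; have [z' Ez' le_z'] := eb _ _ _ _ Xx Yy Nx Ny.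
  exact: le_trans (dist_le _ Ecl Ez') le_z'.
have beta0 := beta_mu_gt0 A mu_gt0 c0.
exists c; split=> // [z Zz|eta eta0 eta_le x y Xx1 Yy1 gda].
  (* The minimum is attained, at the normal vector nearest to - F. *)
  have [|v [Nv vmin]] := nearest_point (- F_mu A mu z)
    (@normal_cone_closed _ _ (prod_set X Y) z).
    by exists 0 => z' _; rewrite dot0l.
  have nE w : norm2 (F_mu A mu z + w) = norm2 (- F_mu A mu z - w).
    by rewrite -norm2N opprD.
  rewrite (@minimumE _ _ (norm2 (F_mu A mu z + v))); first last.
  - by move=> _ [w Nw <-]; rewrite !nE; exact: vmin.
  - by exists v.
  have [Nx Ny] := normal_cone_prod Zz Nv; have [Xz Yz] := Zz.
  have := dist_eb _ _ _ _ Xz Yz Nx Ny.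
  by rewrite -add_col_mx !vsubmxK.
have in_t t : X (x t.+1) /\ Y (y t.+1).
  elim: t => [//|t _]; have [-> ->] := gda t.+1 isT.
  split; apply: proj_in => //; apply: polyhedron_closed.
    exact: X_polytope.1.
  exact: Y_polytope.1.
have step t : dist (col_mx (x t.+2) (y t.+2)) (equilibria A X Y mu) ^+ 2 <=
    1 / (1 + eta ^+ 2 / (2 * beta_mu A mu c ^+ 2)) *
    dist (col_mx (x t.+1) (y t.+1)) (equilibria A X Y mu) ^+ 2.
  have [Xx Yy] := in_t t.
  have [xE yE] := gda t.+1 isT; rewrite yE xE => {xE yE}.
  set x' := proj X _; set y' := proj Y _.
  have [vx [vy [Xx' Yy' Nx Ny res]]] :=
    step_residual A X_polytope Y_polytope mu_gt0 eta0 Xx Yy.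
  rewrite -/x' -/y' in Xx' Yy' Nx Ny res.
  have Ez0 := proj_in (col_mx (x t.+1) (y t.+1)) Ecl E0.
  apply: (@contraction _ _ _ _ _ (norm2 (col_mx (x t.+1) (y t.+1) - col_mx x' y'))
    eta0 beta0 (norm2_ge0 _)).
    apply: (@le_trans _ _ (c * (1 + eta * (mu + spectral_norm A)) *
        norm2 (col_mx (x t.+1) (y t.+1) - col_mx x' y'))); last first.
      by rewrite ler_wpM2r ?norm2_ge0 // beta_mu_ge.
    rewrite -mulrA; apply: le_trans (ler_wpM2l (ltW c0) res).
    by rewrite mulrCA ler_pM2l //; exact: dist_eb.
  have /(equilibriaP A X_polytope Y_polytope X_nonempty Y_nonempty mu_gt0) sad := Ez0.
  have := step_descent X_polytope Y_polytope mu_gt0 eta0 eta_le sad Xx Yy.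
  rewrite vsubmxK -/x' -/y'; apply: le_trans; rewrite lerD2r.
  have le_z0 := dist_le (col_mx x' y') Ecl Ez0.
  exact: (ler_pM (norm2_ge0 _) (norm2_ge0 _) le_z0 le_z0).
case=> [//|t] _; rewrite subn1 /=; elim: t => [|t IH]; first by rewrite expr0 mul1r.
apply: le_trans (step t) _; rewrite [_ ^+ t.+1]exprS -[leRHS]mulrA.
apply: (ler_wpM2l _ IH); rewrite divr_ge0 // addr_ge0 //.
by rewrite (divr_ge0 (sqr_ge0 _) (mulr_ge0 (ler0n _ 2) (sqr_ge0 _))).
Qed.
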